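(* Let $\mathcal R$ be a unital ring and let $M$ be a nonzero right $\mathcal R$-module. Then there is a split embedding $\mathbb Z\rightarrowtail K_0(M)$, i.e. an injective ring homomorphism $\mathbb Z\to K_0(M)$ that admits a left inverse ring homomorphism $K_0(M)\to\mathbb Z$.
   Context: A right $\mathcal R$-module $M$ is viewed as a first order structure in the language $\langle 0,+,-,m_r: r\in\mathcal R\rangle$, where $m_r$ is interpreted as right multiplication by $r$. ''Definable'' means definable (first order) with parameters from $M$. Two definable sets $A\subseteq M^n$, $B\subseteq M^m$ ($n,m\ge1$) are definably isomorphic if there is a bijection $A\to B$ with definable graph; $[A]$ denotes the equivalence class. The set $\widetilde{\mathrm{Def}}(M)$ of all classes is a commutative semiring with $0=[\emptyset]$, $1=[\text{singleton}]$, $[A]+[B]=[A'\sqcup B']$ for disjoint $A'\in[A]$, $B'\in[B]$, and $[A]\cdot[B]=[A\times B]$. $K_0(M)$ is the Grothendieck ring of this semiring, i.e. the ring with the universal semiring homomorphism from $\widetilde{\mathrm{Def}}(M)$ to a commutative ring. *)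

(* Defs.v *)
From HB Require Import structures.
From mathcomp Require Import all_boot all_order all_algebra ring.
From mathcomp Require Import boolp classical_sets functions.
Set Implicit Arguments.
Unset Strict Implicit.
Unset Printing Implicit Defensive.
Import GRing.Theory.
Local Open Scope classical_set_scope.
Local Open Scope ring_scope.
Local Open Scope quotient_scope.

(** * Grothendieck ring of a commutative semiring

   Formal differences [x.1 - x.2], where [x] and [y] are identified when
   [x.1 + y.2 + k = y.1 + x.2 + k] for some [k].  Rings are [comPzRingType]s
   here, so that the zero ring is not excluded. *)
Section Grothendieck.
Variable S : comPzSemiRingType.
Implicit Types x y z : S * S.

Definition gr_equiv x y : bool :=
  `[< exists k, x.1 + y.2 + k = y.1 + x.2 + k >].

Lemma gr_equivP x y :
  reflect (exists k, x.1 + y.2 + k = y.1 + x.2 + k) (gr_equiv x y).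
Proof. exact: asboolP. Qed.

Lemma gr_equiv_refl : reflexive gr_equiv.
Proof. by move=> x; apply/gr_equivP; exists 0. Qed.

Lemma gr_equiv_sym : symmetric gr_equiv.
Proof. by move=> x y; apply/gr_equivP/gr_equivP => -[k h]; exists k. Qed.

Lemma gr_equiv_trans : transitive gr_equiv.
Proof.
move=> y x z /gr_equivP[k h] /gr_equivP[l h']; apply/gr_equivP.
exists (y.1 + y.2 + k + l).
have -> : x.1 + z.2 + (y.1 + y.2 + k + l) = (x.1 + y.2 + k) + (y.1 + z.2 + l).
  by ring.
by rewrite h h'; ring.
Qed.

Canonical gr_equivRel :=
  EquivRel gr_equiv gr_equiv_refl gr_equiv_sym gr_equiv_trans.

Definition groth := {eq_quot gr_equivRel}.
HB.instance Definition _ := Choice.on groth.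
HB.instance Definition _ := EqQuotient.on groth.

Lemma groth_eqP x y :
  \pi_groth x = \pi_groth y <-> exists k, x.1 + y.2 + k = y.1 + x.2 + k.
Proof.
split=> [/eqmodP/gr_equivP //|h]; by apply/eqmodP/gr_equivP.
Qed.

Definition groth0 : groth := \pi_groth (0, 0).
Definition groth1 : groth := \pi_groth (1, 0).
Definition groth_opp (u : groth) : groth :=
  \pi_groth ((repr u).2, (repr u).1).
Definition groth_add (u v : groth) : groth :=
  \pi_groth ((repr u).1 + (repr v).1, (repr u).2 + (repr v).2).
Definition groth_mul (u v : groth) : groth :=
  \pi_groth ((repr u).1 * (repr v).1 + (repr u).2 * (repr v).2,
             (repr u).1 * (repr v).2 + (repr u).2 * (repr v).1).

Lemma groth_repr x :
  exists k, (repr (\pi_groth x)).1 + x.2 + k = x.1 + (repr (\pi_groth x)).2 + k.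
Proof. by apply/groth_eqP; rewrite reprK. Qed.

Lemma groth_oppE x : groth_opp (\pi x) = \pi_groth (x.2, x.1).
Proof.
apply/groth_eqP => /=; have [k h] := groth_repr x; exists k.
by rewrite [_ + x.1]addrC -h addrC [x.2 + _]addrC addrC.
Qed.

Lemma groth_addE x y :
  groth_add (\pi x) (\pi y) = \pi_groth (x.1 + y.1, x.2 + y.2).
Proof.
apply/groth_eqP => /=; have [k h] := groth_repr x; have [l h'] := groth_repr y.
exists (k + l); set a := repr _ in h *; set b := repr _ in h' *.
transitivity ((a.1 + x.2 + k) + (b.1 + y.2 + l)); first by ring.
by rewrite h h'; ring.
Qed.

Lemma groth_mulE x y :
  groth_mul (\pi x) (\pi y) =
  \pi_groth (x.1 * y.1 + x.2 * y.2, x.1 * y.2 + x.2 * y.1).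
Proof.
have step1 (a b c : S * S) : \pi_groth a = \pi_groth b ->
    \pi_groth (a.1 * c.1 + a.2 * c.2, a.1 * c.2 + a.2 * c.1) =
    \pi_groth (b.1 * c.1 + b.2 * c.2, b.1 * c.2 + b.2 * c.1).
  move=> /groth_eqP[k h]; apply/groth_eqP; exists (k * c.1 + k * c.2) => /=.
  transitivity ((a.1 + b.2 + k) * c.1 + (b.1 + a.2 + k) * c.2); first by ring.
  by rewrite -h {1}h; ring.
have sw (a c : S * S) :
    (a.1 * c.1 + a.2 * c.2, a.1 * c.2 + a.2 * c.1) =
    (c.1 * a.1 + c.2 * a.2, c.1 * a.2 + c.2 * a.1).
  by congr (_, _); ring.
rewrite /groth_mul (step1 _ x) ?reprK // sw (step1 _ y) ?reprK //.
by rewrite -sw.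
Qed.

Definition grothE := (groth_addE, groth_mulE, groth_oppE).

Let pi_ext (u v : S * S) : u.1 = v.1 -> u.2 = v.2 -> \pi_groth u = \pi_groth v.
Proof. by case: u v => [? ?] [? ?] /= -> ->. Qed.

Fact groth_addA : associative groth_add.
Proof.
elim/quotW=> x; elim/quotW=> y; elim/quotW=> z.
by rewrite !grothE; apply: pi_ext => /=; ring.
Qed.

Fact groth_addC : commutative groth_add.
Proof.
elim/quotW=> x; elim/quotW=> y.
by rewrite !grothE; apply: pi_ext => /=; ring.
Qed.

Fact groth_add0 : left_id groth0 groth_add.
Proof. by elim/quotW=> x; rewrite !grothE; apply: pi_ext => /=; ring. Qed.

Fact groth_addN : left_inverse groth0 groth_opp groth_add.
Proof.
by elim/quotW=> x; rewrite !grothE; apply/groth_eqP; exists 0 => /=; ring.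
Qed.

HB.instance Definition _ :=
  GRing.isZmodule.Build groth groth_addA groth_addC groth_add0 groth_addN.

Fact groth_mulA : associative groth_mul.
Proof.
elim/quotW=> x; elim/quotW=> y; elim/quotW=> z.
by rewrite !grothE; apply: pi_ext => /=; ring.
Qed.

Fact groth_mulC : commutative groth_mul.
Proof.
elim/quotW=> x; elim/quotW=> y.
by rewrite !grothE; apply: pi_ext => /=; ring.
Qed.

Fact groth_mul1 : left_id groth1 groth_mul.
Proof. by elim/quotW=> x; rewrite !grothE; apply: pi_ext => /=; ring. Qed.

Fact groth_mulD : left_distributive groth_mul groth_add.
Proof.
elim/quotW=> x; elim/quotW=> y; elim/quotW=> z.
by rewrite !grothE; apply: pi_ext => /=; ring.
Qed.

HB.instance Definition _ := GRing.Zmodule_isComPzRing.Build groth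
  groth_mulA groth_mulC groth_mul1 groth_mulD.

Definition groth_in (s : S) : groth := \pi_groth (s, 0).

Fact groth_in_is_nmod_morphism : nmod_morphism groth_in.
Proof.
split=> // s t; rewrite [RHS]groth_addE.
by apply: pi_ext => //=; rewrite addr0.
Qed.

Fact groth_in_is_monoid_morphism : monoid_morphism groth_in.
Proof.
split=> // s t; rewrite [RHS]groth_mulE.
by apply: pi_ext => /=; ring.
Qed.

HB.instance Definition _ :=
  GRing.isNmodMorphism.Build S groth groth_in groth_in_is_nmod_morphism.
HB.instance Definition _ :=
  GRing.isMonoidMorphism.Build S groth groth_in groth_in_is_monoid_morphism.

Lemma groth_inB u : u = groth_in (repr u).1 - groth_in (repr u).2.
Proof.
rewrite -[LHS]reprK; case: (repr u) => a b /=.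
rewrite /groth_in [- _]groth_oppE [RHS]groth_addE.
by apply: pi_ext => /=; ring.
Qed.

Theorem groth_universal (A : comPzRingType) (f : {rmorphism S -> A}) :
  exists! g : groth -> A,
    [/\ zmod_morphism g, monoid_morphism g & forall s, g (groth_in s) = f s].
Proof.
pose g (u : groth) := f (repr u).1 - f (repr u).2.
have gE x : g (\pi x) = f x.1 - f x.2.
  have [k] := groth_repr x; rewrite /g; set a := repr _ => h.
  have /addIr : f a.1 + f x.2 + f k = f x.1 + f a.2 + f k by rewrite -!rmorphD h.
  move=> e; apply/eqP; rewrite -subr_eq0; apply/eqP.
  transitivity ((f a.1 + f x.2) - (f x.1 + f a.2)); first by ring.
  by rewrite e subrr.
exists g; split; first split.
- elim/quotW=> x; elim/quotW=> y.
  rewrite [- _]groth_oppE [_ + _ in LHS]groth_addE !gE /= !rmorphD; ring.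
- split=> [|u v]; first by rewrite [LHS]gE /= rmorph1 rmorph0 subr0.
  move: u v; elim/quotW=> x; elim/quotW=> y.
  rewrite [_ * _ in LHS]groth_mulE !gE /= !(rmorphD, rmorphM); ring.
- by move=> s; rewrite gE /= rmorph0 subr0.
move=> h [hB _ hin]; apply/funext => u.
by rewrite [in RHS](groth_inB u) hB !hin.
Qed.

End Grothendieck.

(** * Definable sets in a right module

   A right [R]-module is a left module over the converse ring [R^c]. *)
Section Language.
Variables (R : pzRingType) (M : lmodType R^c).

(* Parameters from [M] are constants of the language. *)
Inductive term :=
  | Var of nat
  | Par of M
  | Zero
  | Add of term & term
  | Opp of term
  | Scale of R & term.

(* Variables are de Bruijn indices: [Ex] binds variable 0. *)
Inductive formula :=
  | Eq of term & term
  | Not of formula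
  | And of formula & formula
  | Ex of formula.

Implicit Types (e : nat -> M) (t : term) (p q : formula).

Fixpoint eval e t : M :=
  match t with
  | Var i => e i
  | Par a => a
  | Zero => 0
  | Add t u => eval e t + eval e u
  | Opp t => - eval e t
  | Scale r t => (r : R^c) *: eval e t
  end.

Definition scons (a : M) e : nat -> M := fun i => if i is j.+1 then e j else a.

Fixpoint holds e p : Prop :=
  match p with
  | Eq t u => eval e t = eval e u
  | Not p => ~ holds e p
  | And p q => holds e p /\ holds e q
  | Ex p => exists a, holds (scons a e) p
  end.

(* Variables beyond the dimension are read as 0, which is a constant of the
   language, hence harmless. *)
Definition env n (x : 'rV[M]_n) : nat -> M :=
  fun i => if insub i is Some j then x 0 j else 0.

Definition definable n (A : set 'rV[M]_n) : Prop :=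
  exists p, forall x, A x <-> holds (env x) p.

Definition graph n m (A : set 'rV[M]_n) (f : 'rV[M]_n -> 'rV[M]_m) :
    set 'rV[M]_(n + m) :=
  [set row_mx x (f x) | x in A].

Definition def_iso n m (A : set 'rV[M]_n) (B : set 'rV[M]_m) : Prop :=
  exists f : 'rV[M]_n -> 'rV[M]_m, set_bij A B f /\ definable (graph A f).

(** ** Closure properties of definable sets *)

(* [definable] at the level of environments, with no dimension *)
Definition tdef (P : (nat -> M) -> Prop) := exists p, forall e, P e <-> holds e p.

Fixpoint ren (s : nat -> nat) t : term :=
  match t with
  | Var i => Var (s i)
  | Par a => Par a
  | Zero => Zero
  | Add t u => Add (ren s t) (ren s u)
  | Opp t => Opp (ren s t)
  | Scale r t => Scale r (ren s t)
  end.

Fixpoint tsubst (s : nat -> term) t : term :=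
  match t with
  | Var i => s i
  | Par a => Par a
  | Zero => Zero
  | Add t u => Add (tsubst s t) (tsubst s u)
  | Opp t => Opp (tsubst s t)
  | Scale r t => Scale r (tsubst s t)
  end.

Definition up (s : nat -> term) : nat -> term :=
  fun i => if i is j.+1 then ren S (s j) else Var 0.

Fixpoint subst (s : nat -> term) p : formula :=
  match p with
  | Eq t u => Eq (tsubst s t) (tsubst s u)
  | Not p => Not (subst s p)
  | And p q => And (subst s p) (subst s q)
  | Ex p => Ex (subst (up s) p)
  end.

Lemma eval_ren e s t : eval e (ren s t) = eval (e \o s) t.
Proof. by elim: t => //= [t -> u ->|t ->|r t ->]. Qed.

Lemma eval_subst e s t : eval e (tsubst s t) = eval (fun i => eval e (s i)) t.
Proof. by elim: t => //= [t -> u ->|t ->|r t ->]. Qed.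

Lemma holds_subst e s p :
  holds e (subst s p) <-> holds (fun i => eval e (s i)) p.
Proof.
elim: p e s => [t u|p IH|p IHp q IHq|p IH] e s /=.
- by rewrite !eval_subst.
- by rewrite IH.
- by rewrite IHp IHq.
- have E a : (fun i => eval (scons a e) (up s i)) =
             scons a (fun i => eval e (s i)).
    by apply/funext => -[|i] //=; rewrite eval_ren.
  by split=> -[a]; exists a; [rewrite -E -IH|rewrite IH E].
Qed.

Lemma tdef_ext P Q : (forall e, P e <-> Q e) -> tdef P -> tdef Q.
Proof. by move=> h [p hp]; exists p => e; rewrite -h. Qed.

Lemma tdef_not P : tdef P -> tdef (fun e => ~ P e).
Proof. by move=> [p hp]; exists (Not p) => e /=; rewrite hp. Qed.

Lemma tdef_and P Q : tdef P -> tdef Q -> tdef (fun e => P e /\ Q e).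
Proof. by move=> [p hp] [q hq]; exists (And p q) => e /=; rewrite hp hq. Qed.

Lemma tdef_ex P : tdef P -> tdef (fun e => exists a, P (scons a e)).
Proof.
by move=> [p hp]; exists (Ex p) => e /=; split=> -[a h]; exists a; exact/hp.
Qed.

Lemma tdef_subst P s : tdef P -> tdef (fun e => P (fun i => eval e (s i))).
Proof. by move=> [p hp]; exists (subst s p) => e; rewrite hp holds_subst. Qed.

Lemma tdef_exs m P :
  tdef P -> tdef (fun e => exists2 s : seq M, size s = m & P (foldr scons e s)).
Proof.
elim: m P => [|m IH] P hP.
  by apply: tdef_ext hP => e; split=> [h|[[] //]]; exists nil.
apply: tdef_ext (IH _ (tdef_ex hP)) => e; split.
- by move=> [s sz [a h]]; exists (a :: s) => //=; rewrite sz.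
- by move=> [[|a s] //= [sz] h]; exists s => //; exists a.
Qed.

Lemma envE n (x : 'rV[M]_n) (i : 'I_n) : env x i = x 0 i.
Proof. by rewrite /env valK. Qed.

Lemma env_out n (x : 'rV[M]_n) i : (n <= i)%N -> env x i = 0.
Proof. by move=> h; rewrite /env insubN // -leqNgt. Qed.

Lemma env_row_mx m n (y : 'rV[M]_m) (x : 'rV[M]_n) :
  env (row_mx y x) = foldr scons (env x) [seq y 0 i | i <- enum 'I_m].
Proof.
set s := [seq _ | _ <- _].
have szs : size s = m by rewrite size_map size_enum_ord.
have F (e : nat -> M) (r : seq M) i : foldr scons e r i =
    if (i < size r)%N then nth 0 r i else e (i - size r)%N.
  elim: r i => [|a r IH] i; first by rewrite /= subn0.
  case: i => [//|i] /=.
  by rewrite IH ltnS subSS.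
apply/funext => i; rewrite F szs; case: ltnP => im.
  transitivity (row_mx y x 0 (lshift n (Ordinal im))); first by rewrite -envE.
  rewrite row_mxEl (nth_map (Ordinal im)) ?size_enum_ord //; congr (y 0 _).
  by apply: val_inj; rewrite /= nth_enum_ord.
have [imn|imn] := ltnP (i - m) n.
  transitivity (row_mx y x 0 (rshift m (Ordinal imn))).
    by rewrite -envE /= subnKC.
  by rewrite row_mxEr -envE.
by rewrite !env_out // -leq_subRL.
Qed.

Lemma definable_tdef n (P : (nat -> M) -> Prop) :
  tdef P -> definable [set x : 'rV_n | P (env x)].
Proof. by move=> [p hp]; exists p => x; exact: hp. Qed.

Lemma definable_ext n (A B : set 'rV[M]_n) :
  (forall x, A x <-> B x) -> definable A -> definable B.
Proof. by move=> h [p hp]; exists p => x; rewrite -h. Qed.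

Lemma definableC n (A : set 'rV[M]_n) : definable A -> definable (~` A).
Proof. by move=> [p hp]; exists (Not p) => x /=; rewrite -hp. Qed.

Lemma definableI n (A B : set 'rV[M]_n) :
  definable A -> definable B -> definable (A `&` B).
Proof. by move=> [p hp] [q hq]; exists (And p q) => x /=; rewrite -hp -hq. Qed.

Lemma definableU n (A B : set 'rV[M]_n) :
  definable A -> definable B -> definable (A `|` B).
Proof.
move=> dA dB; rewrite -[_ `|` _]setCK setCU.
by apply: definableC; apply: definableI; exact: definableC.
Qed.

Lemma definable_proj m n (B : set 'rV[M]_(m + n)) :
  definable B -> definable [set x | exists y : 'rV[M]_m, B (row_mx y x)].
Proof.
move=> [p hp]; have /(tdef_exs m)/(@definable_tdef n) : tdef (holds^~ p).
  by exists p.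
apply: definable_ext => x; split=> [[s sz h]|[y /hp]].
- exists (\row_i nth 0 s i); apply/hp; rewrite env_row_mx.
  suff -> : [seq (\row_i0 nth 0 s i0) 0 i | i <- enum 'I_m] = s by [].
  apply: (@eq_from_nth _ 0) => [|i]; rewrite size_map size_enum_ord // => im.
  rewrite -[i]/(val (Ordinal im)) (nth_map (Ordinal im)) ?size_enum_ord //.
  by rewrite nth_ord_enum mxE.
- rewrite env_row_mx => h; eexists; last exact: h.
  by rewrite size_map size_enum_ord.
Qed.

(* maps whose coordinates are given by terms *)
Definition tmap n m (g : 'rV[M]_n -> 'rV[M]_m) :=
  forall j, exists t, forall x, g x 0 j = eval (env x) t.

Lemma tmap_id n : tmap (@id 'rV[M]_n).
Proof. by move=> j; exists (Var j) => x /=; rewrite envE. Qed.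

Lemma tmap_cst n m (c : 'rV[M]_m) : tmap (fun _ : 'rV[M]_n => c).
Proof. by move=> j; exists (Par (c 0 j)). Qed.

Lemma tmap_l n m k (g : 'rV[M]_n -> 'rV[M]_(m + k)) :
  tmap g -> tmap (fun x => lsubmx (g x)).
Proof. by move=> h j; case: (h (lshift k j)) => t ht; exists t => x; rewrite mxE. Qed.

Lemma tmap_r n m k (g : 'rV[M]_n -> 'rV[M]_(m + k)) :
  tmap g -> tmap (fun x => rsubmx (g x)).
Proof. by move=> h j; case: (h (rshift m j)) => t ht; exists t => x; rewrite mxE. Qed.

Lemma tmap_row n m k (g : 'rV[M]_n -> 'rV[M]_m) (h : 'rV[M]_n -> 'rV[M]_k) :
  tmap g -> tmap h -> tmap (fun x => row_mx (g x) (h x)).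
Proof.
move=> hg hh j; case: (split_ordP j) => i ->.
- by case: (hg i) => t ht; exists t => x; rewrite row_mxEl.
- by case: (hh i) => t ht; exists t => x; rewrite row_mxEr.
Qed.

Lemma definable_preim n m (g : 'rV[M]_n -> 'rV[M]_m) (B : set 'rV[M]_m) :
  tmap g -> definable B -> definable [set x | B (g x)].
Proof.
move=> hg [p hp]; have {hg} [s hs] := choice hg.
pose s' i := if insub i is Some j then s j else Zero.
exists (subst s' p) => x; rewrite holds_subst /mkset hp.
suff -> : env (g x) = (fun i => eval (env x) (s' i)) by [].
by apply/funext => i; rewrite /env /s'; case: insubP => //= j _ _; rewrite hs.
Qed.

Lemma definable_eq n m (g h : 'rV[M]_n -> 'rV[M]_m) :
  tmap g -> tmap h -> definable [set x | g x = h x].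
Proof.
move=> hg hh; have {hg} [s hs] := choice hg; have {hh} [t ht] := choice hh.
pose T := Eq Zero Zero.
exists (foldr (fun j p => And (Eq (s j) (t j)) p) T (enum 'I_m)) => x.
have -> : holds (env x) (foldr (fun j p => And (Eq (s j) (t j)) p) T (enum 'I_m))
    <-> (forall j, j \in enum 'I_m -> g x 0 j = h x 0 j).
  elim: (enum 'I_m) => [|j r IH] //=; rewrite IH -hs -ht; split.
  - by move=> [h1 h2] i; rewrite inE => /predU1P[->|/h2].
  - by move=> H; split=> [|i ir]; apply: H; rewrite inE ?eqxx ?ir ?orbT.
split=> [->//|H]; apply/rowP => j; apply: H; exact: mem_enum.
Qed.

Lemma definable0 n : definable (@set0 'rV[M]_n).
Proof. by exists (Not (Eq Zero Zero)) => x /=; split=> // /(_ erefl). Qed.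

Lemma definable1 n (a : 'rV[M]_n) : definable [set a].
Proof. exact: definable_eq (@tmap_id n) (@tmap_cst n n a). Qed.

Definition prod_set n m (A : set 'rV[M]_n) (B : set 'rV[M]_m) :
    set 'rV[M]_(n + m) :=
  [set z | A (lsubmx z) /\ B (rsubmx z)].

Lemma definable_prod n m (A : set 'rV[M]_n) (B : set 'rV[M]_m) :
  definable A -> definable B -> definable (prod_set A B).
Proof.
move=> dA dB; apply: definableI.
- exact: definable_preim (tmap_l (@tmap_id _)) dA.
- exact: definable_preim (tmap_r (@tmap_id _)) dB.
Qed.

Lemma definable_image n m (g : 'rV[M]_n -> 'rV[M]_m) (A : set 'rV[M]_n) :
  tmap g -> definable A -> definable (g @` A).
Proof.
move=> hg dA.
have hl : tmap (fun z : 'rV[M]_(n + m) => g (lsubmx z)).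
  move=> j; have [t ht] := hg j.
  pose s i := if (i < n)%N then Var i else Zero.
  exists (tsubst s t) => z; rewrite ht eval_subst; congr eval.
  apply/funext => i; rewrite /s; case: ltnP => im /=; last by rewrite env_out.
  by rewrite -[i]/(val (Ordinal im)) envE mxE -envE.
have := definableI (definable_preim (tmap_l (@tmap_id (n + m))) dA)
                   (definable_eq hl (tmap_r (@tmap_id (n + m)))).
move=> /definable_proj; apply: definable_ext => y; split.
- by move=> [x []] /=; rewrite row_mxKl row_mxKr => Ax <-; exists x.
- by move=> [x Ax <-]; exists x; split; rewrite /= row_mxKl ?row_mxKr.
Qed.

(** ** Definable isomorphism *)

Lemma def_isoP n m (A : set 'rV[M]_n) (B : set 'rV[M]_m) :
  def_iso A B <-> exists G,
    [/\ definable [set z | G (lsubmx z) (rsubmx z)],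
        forall x y, G x y -> A x /\ B y,
        forall x, A x -> exists y, G x y,
        forall y, B y -> exists x, G x y &
        forall x y x' y', G x y -> G x' y' -> x = x' <-> y = y'].
Proof.
split=> [[f [[fAB finj fsurj] df]]|[G [dG GAB GA GB Gf]]].
  exists (fun x y => A x /\ y = f x); split=> /=.
  - apply: definable_ext df => z; split=> [[x Ax <-]|[Az zE]].
      by rewrite /= row_mxKl row_mxKr.
    by exists (lsubmx z) => //; rewrite -zE hsubmxK.
  - by move=> x y [Ax ->]; split=> //; exact: fAB.
  - by move=> x Ax; exists (f x).
  - by move=> y /fsurj[x Ax <-]; exists x.
  - move=> x y x' y' [Ax ->] [Ax' ->]; split=> [->//|]; apply: finj; exact/mem_set.
have /choice[f hf] : forall x, exists y, A x -> G x y.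
  move=> x; case: (pselect (A x)) => [/GA[y]|nA]; first by exists y.
  by exists 0.
exists f; split; first split.
- by move=> x /= /hf/GAB[].
- by move=> x x' /set_mem/hf Gx /set_mem/hf Gx'; move/(Gf _ _ _ _ Gx Gx').
- move=> y /GB[x Gx]; have [Ax _] := GAB _ _ Gx; exists x => //.
  exact/(Gf _ _ _ _ (hf _ Ax) Gx).
apply: definable_ext dG => z; split=> [Gz|[x /hf Gx <-]] /=.
  have [Az _] := GAB _ _ Gz; exists (lsubmx z) => //.
  by rewrite -[RHS]hsubmxK; congr row_mx; apply/(Gf _ _ _ _ (hf _ Az) Gz).
by rewrite row_mxKl row_mxKr.
Qed.

Lemma def_iso_sym n m (A : set 'rV[M]_n) (B : set 'rV[M]_m) :
  def_iso A B -> def_iso B A.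
Proof.
move=> /def_isoP[G [dG GAB GA GB Gf]]; apply/def_isoP; exists (fun y x => G x y).
split=> //.
- have := definable_preim
    (tmap_row (tmap_r (@tmap_id (m + n))) (tmap_l (@tmap_id (m + n)))) dG.
  by apply: definable_ext => z /=; rewrite row_mxKl row_mxKr.
- by move=> x y /GAB[].
- by move=> x y x' y' h h'; split=> /(Gf _ _ _ _ h h').
Qed.

Lemma def_iso_trans n m k (A : set 'rV[M]_n) (B : set 'rV[M]_m)
    (C : set 'rV[M]_k) : def_iso A B -> def_iso B C -> def_iso A C.
Proof.
move=> /def_isoP[G [dG GAB GA GB Gf]] /def_isoP[H [dH HBC HB HC Hf]].
apply/def_isoP; exists (fun x z => exists2 y, G x y & H y z); split.
- have hid := @tmap_id (m + (n + k)).
  have := definable_proj (definableI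
    (definable_preim (tmap_row (tmap_l (tmap_r hid)) (tmap_l hid)) dG)
    (definable_preim (tmap_row (tmap_l hid) (tmap_r (tmap_r hid))) dH)).
  apply: definable_ext => z; split=> -[y]; [case=> /=|move=> Gy Hy; exists y];
    rewrite ?row_mxKl ?row_mxKr; first by exists y.
  by split; rewrite /= ?row_mxKl ?row_mxKr.
- by move=> x z [y /GAB[? _] /HBC[_ ?]].
- by move=> x /GA[y Gy]; have [_ /HB[z Hz]] := GAB _ _ Gy; exists z, y.
- by move=> z /HC[y Hy]; have [/GB[x Gx] _] := HBC _ _ Hy; exists x, y.
- move=> x z x' z' [y Gy Hy] [y' Gy' Hy'].
  by rewrite (Gf _ _ _ _ Gy Gy'); exact: Hf Hy Hy'.
Qed.

Lemma def_iso_image n m (g : 'rV[M]_n -> 'rV[M]_m) (A : set 'rV[M]_n)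
    (B : set 'rV[M]_m) :
  definable A -> tmap g -> set_bij A B g -> def_iso A B.
Proof.
move=> dA hg bij; exists g; split=> //.
exact: (definable_image (tmap_row (@tmap_id n) hg) dA).
Qed.

Lemma def_iso_refl n (A : set 'rV[M]_n) : definable A -> def_iso A A.
Proof.
move=> dA; apply: (def_iso_image dA (@tmap_id n)); split=> //.
by move=> x Ax; exists x.
Qed.

Lemma def_isoU n m (A A' : set 'rV[M]_n) (B B' : set 'rV[M]_m) :
  A `&` A' = set0 -> B `&` B' = set0 -> def_iso A B -> def_iso A' B' ->
  def_iso (A `|` A') (B `|` B').
Proof.
move=> dA dB /def_isoP[G [dG GAB GA GB Gf]] /def_isoP[H [dH HAB HA HB Hf]].
have NA x : A x -> A' x -> False by move=> h h'; have : set0 x by rewrite -dA.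
have NB x : B x -> B' x -> False by move=> h h'; have : set0 x by rewrite -dB.
apply/def_isoP; exists (fun x y => G x y \/ H x y); split.
- exact: definableU dG dH.
- by move=> x y [/GAB[]|/HAB[]]; split; [left|left|right|right].
- by move=> x [/GA|/HA] [y h]; exists y; [left|right].
- by move=> y [/GB|/HB] [x h]; exists x; [left|right].
- move=> x y x' y' [g|h] [g'|h']; [exact: Gf g g'| | |exact: Hf h h'].
  + have [a b] := GAB _ _ g; have [a' b'] := HAB _ _ h'.
    by split=> E; exfalso; subst; [exact: NA a a'|exact: NB b b'].
  + have [a b] := HAB _ _ h; have [a' b'] := GAB _ _ g'.
    by split=> E; exfalso; subst; [exact: NA a' a|exact: NB b' b].
Qed.

Lemma def_iso_prod n n' m m' (A : set 'rV[M]_n) (A' : set 'rV[M]_n')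
    (B : set 'rV[M]_m) (B' : set 'rV[M]_m') :
  def_iso A A' -> def_iso B B' -> def_iso (prod_set A B) (prod_set A' B').
Proof.
move=> /def_isoP[G [dG GAB GA GB Gf]] /def_isoP[H [dH HAB HA HB Hf]].
apply/def_isoP.
exists (fun x y => G (lsubmx x) (lsubmx y) /\ H (rsubmx x) (rsubmx y)); split.
- have hid := @tmap_id ((n + m) + (n' + m')).
  have := definableI
    (definable_preim (tmap_row (tmap_l (tmap_l hid)) (tmap_l (tmap_r hid))) dG)
    (definable_preim (tmap_row (tmap_r (tmap_l hid)) (tmap_r (tmap_r hid))) dH).
  by apply: definable_ext => z; rewrite /setI /= !row_mxKl !row_mxKr.
- by move=> x y [/GAB[? ?] /HAB[? ?]].
- move=> x [/GA[y Gy] /HA[z Hz]]; exists (row_mx y z).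
  by rewrite row_mxKl row_mxKr.
- move=> x [/GB[y Gy] /HB[z Hz]]; exists (row_mx y z).
  by rewrite row_mxKl row_mxKr.
- move=> x y x' y' [g h] [g' h']; split=> E.
  + rewrite -(hsubmxK y) -(hsubmxK y'); congr row_mx.
      by apply/(Gf _ _ _ _ g g'); rewrite E.
    by apply/(Hf _ _ _ _ h h'); rewrite E.
  + rewrite -(hsubmxK x) -(hsubmxK x'); congr row_mx.
      by apply/(Gf _ _ _ _ g g'); rewrite E.
    by apply/(Hf _ _ _ _ h h'); rewrite E.
Qed.

(** ** The semiring of classes of definable sets *)

Record defset := DefSet {
  dim : nat;
  carrier :> set 'rV[M]_dim;
  dim_gt0 : (0 < dim)%N;
  defsetP : definable carrier }.

Implicit Types A B C D : defset.

Definition def_equiv A B : bool := `[< def_iso A B >].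

Lemma def_equiv_refl : reflexive def_equiv.
Proof. by move=> A; apply/asboolP/def_iso_refl/defsetP. Qed.

Lemma def_equiv_sym : symmetric def_equiv.
Proof. by move=> A B; apply/asboolP/asboolP; exact: def_iso_sym. Qed.

Lemma def_equiv_trans : transitive def_equiv.
Proof.
by move=> B A C /asboolP hAB /asboolP hBC; apply/asboolP/(def_iso_trans hAB hBC).
Qed.

HB.instance Definition _ := gen_eqMixin defset.
HB.instance Definition _ := gen_choiceMixin defset.

Canonical def_equivRel :=
  EquivRel def_equiv def_equiv_refl def_equiv_sym def_equiv_trans.

Definition def0 : defset := @DefSet 1 set0 isT (@definable0 1).
Definition def1 : defset := @DefSet 1 [set 0] isT (definable1 0).

Definition defM A B : defset :=
  @DefSet (dim A + dim B) (prod_set A B) (ltn_addr _ (dim_gt0 A))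
    (definable_prod (defsetP A) (defsetP B)).

Definition defU n (h : (0 < n)%N) (X Y : set 'rV[M]_n)
    (dX : definable X) (dY : definable Y) : defset :=
  DefSet h (definableU dX dY).

Definition inj_l n m (x : 'rV[M]_n) : 'rV[M]_(n + m + 1) :=
  row_mx (row_mx x 0) 0.
Definition inj_r (a : M) n m (y : 'rV[M]_m) : 'rV[M]_(n + m + 1) :=
  row_mx (row_mx 0 y) (const_mx a).
Arguments inj_r a n {m} y.

Lemma tmap_inj_l n m : tmap (@inj_l n m).
Proof. exact (tmap_row (tmap_row (@tmap_id n) (@tmap_cst _ _ 0)) (@tmap_cst _ _ 0)). Qed.

Lemma tmap_inj_r a n m : tmap (@inj_r a n m).
Proof. exact (tmap_row (tmap_row (@tmap_cst _ _ 0) (@tmap_id m)) (@tmap_cst _ _ _)). Qed.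

Lemma inj_l_inj n m : injective (@inj_l n m).
Proof. by move=> x y /eq_row_mx[/eq_row_mx[]]. Qed.

Lemma inj_r_inj a n m : injective (@inj_r a n m).
Proof. by move=> x y /eq_row_mx[/eq_row_mx[]]. Qed.

Lemma set_bij_image T T' (X : set T) (g : T -> T') :
  injective g -> set_bij X (g @` X) g.
Proof.
by move=> ig; split=> [x Xx|x y _ _ /ig|y [x Xx <-]] //; exists x.
Qed.

Lemma image_disj T T' (g : T -> T') (X Y : set T) :
  injective g -> X `&` Y = set0 -> (g @` X) `&` (g @` Y) = set0.
Proof.
move=> ig dXY; apply/seteqP; split=> // z [[x Xx <-] [y Yy /ig E]].
by have : set0 x by rewrite -dXY; split=> //; rewrite -E.
Qed.

Definition defS (a : M) A B : defset :=
  @defU (dim A + dim B + 1) (ltn_addr _ (ltn_addr _ (dim_gt0 A)))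
    (inj_l (dim B) @` A) (inj_r a (dim A) @` B)
    (definable_image (@tmap_inj_l _ _) (defsetP A))
    (definable_image (@tmap_inj_r a _ _) (defsetP B)).

Lemma defS_disj a n m (X : set 'rV[M]_n) (Y : set 'rV[M]_m) :
  a != 0 -> (inj_l m @` X) `&` (inj_r a n @` Y) = set0.
Proof.
move=> a0; apply/seteqP; split=> // z [[x _ <-] [y _]].
move=> /eq_row_mx[_ /rowP/(_ 0)]; rewrite !mxE => E.
by rewrite E eqxx in a0.
Qed.

Lemma def_iso_inj_l n m (X : set 'rV[M]_n) :
  definable X -> def_iso X (inj_l m @` X).
Proof.
by move=> dX; apply: (def_iso_image dX (@tmap_inj_l n m));
   exact/set_bij_image/inj_l_inj.
Qed.

Lemma def_iso_inj_r a n m (Y : set 'rV[M]_m) :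
  definable Y -> def_iso Y (inj_r a n @` Y).
Proof.
by move=> dY; apply: (def_iso_image dY (@tmap_inj_r a n m));
   exact/set_bij_image/inj_r_inj.
Qed.

Lemma def_isoS a n (X Y : set 'rV[M]_n) A B : a != 0 ->
  X `&` Y = set0 -> def_iso X A -> def_iso Y B ->
  def_iso (X `|` Y) (defS a A B).
Proof.
move=> a0 dXY hX hY; apply: def_isoU => //; first exact: defS_disj.
- exact/(def_iso_trans hX)/def_iso_inj_l/defsetP.
- exact/(def_iso_trans hY)/def_iso_inj_r/defsetP.
Qed.

Lemma def_iso_prodA n m k (X : set 'rV[M]_n) (Y : set 'rV[M]_m)
    (Z : set 'rV[M]_k) : definable X -> definable Y -> definable Z ->
  def_iso (prod_set X (prod_set Y Z)) (prod_set (prod_set X Y) Z).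
Proof.
move=> dX dY dZ.
have hid := @tmap_id (n + (m + k)).
apply: (def_iso_image (definable_prod dX (definable_prod dY dZ))
  (tmap_row (tmap_row (tmap_l hid) (tmap_l (tmap_r hid)))
            (tmap_r (tmap_r hid)))).
split.
- by move=> x [Xx [Yx Zx]]; split; [split|]; rewrite /= ?row_mxKl ?row_mxKr.
- move=> x y _ _ /eq_row_mx[/eq_row_mx[E1 E2] E3].
  rewrite -(hsubmxK x) -(hsubmxK y) E1 -(hsubmxK (rsubmx x)).
  by rewrite -(hsubmxK (rsubmx y)) E2 E3.
- move=> y [[Xy Yy] Zy].
  exists (row_mx (lsubmx (lsubmx y)) (row_mx (rsubmx (lsubmx y)) (rsubmx y))).
    by split; [|split]; rewrite /= ?(row_mxKl, row_mxKr).
  by rewrite /= !(row_mxKl, row_mxKr) !hsubmxK.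
Qed.

Lemma def_iso_prodC n m (X : set 'rV[M]_n) (Y : set 'rV[M]_m) :
  definable X -> definable Y -> def_iso (prod_set X Y) (prod_set Y X).
Proof.
move=> dX dY; have hid := @tmap_id (n + m).
apply: (def_iso_image (definable_prod dX dY) (tmap_row (tmap_r hid) (tmap_l hid))).
split.
- by move=> x [Xx Yx]; split; rewrite /= ?row_mxKl ?row_mxKr.
- move=> x y _ _ /eq_row_mx[E1 E2].
  by rewrite -(hsubmxK x) -(hsubmxK y) E1 E2.
- move=> y [Yy Xy]; exists (row_mx (rsubmx y) (lsubmx y)).
    by split; rewrite /= ?row_mxKl ?row_mxKr.
  by rewrite /= row_mxKl row_mxKr hsubmxK.
Qed.

Lemma def_iso_prod1 n (X : set 'rV[M]_n) :
  definable X -> def_iso (prod_set def1 X) X.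
Proof.
move=> dX; have hid := @tmap_id (1 + n).
apply: (def_iso_image (definable_prod (defsetP def1) dX) (tmap_r hid)).
split.
- by move=> x [].
- move=> x y /set_mem[x0 _] /set_mem[y0 _] E.
  by rewrite -(hsubmxK x) -(hsubmxK y) E x0 y0.
- move=> x Xx; exists (row_mx 0 x); last by rewrite row_mxKr.
  by split; rewrite /= ?row_mxKl ?row_mxKr.
Qed.

Lemma def_iso_set0 n m (X : set 'rV[M]_n) (Y : set 'rV[M]_m) :
  X = set0 -> Y = set0 -> def_iso X Y.
Proof.
move=> -> ->; apply/def_isoP; exists (fun _ _ => False); split=> //.
exact: definable0.
Qed.

(* Disjoint copies of two arbitrary definable sets exist only if [M] has two
   distinct elements, so the semiring is defined only for a nonzero module. *)
Definition Deftilde (hM : exists a : M, a != 0) := {eq_quot def_equivRel}.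

Section NonZero.
Hypothesis hM : exists a : M, a != 0.
Local Notation T := (Deftilde hM).
Implicit Types u v w : T.
HB.instance Definition _ := Choice.on T.
HB.instance Definition _ := EqQuotient.on T.

Definition cls A : T := \pi_T A.

Lemma cls_eqP A B : cls A = cls B <-> def_iso A B.
Proof. by split=> [/eqmodP/asboolP //|h]; apply/eqmodP/asboolP. Qed.

Let a0 : M := xchoose hM.
Let a0_neq0 : a0 != 0 := xchooseP hM.

Definition cls_add (u v : T) : T := cls (defS (xchoose hM) (repr u) (repr v)).
Definition cls_mul (u v : T) : T := cls (defM (repr u) (repr v)).

Lemma cls_surj u : exists A, u = cls A.
Proof. by exists (repr u); rewrite /cls reprK. Qed.

Lemma repr_cls A : def_iso (repr (cls A)) A.
Proof. by apply/cls_eqP; rewrite /cls reprK. Qed.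

Lemma cls_mulE A B : cls_mul (cls A) (cls B) = cls (defM A B).
Proof. by apply/cls_eqP; apply: def_iso_prod; exact: repr_cls. Qed.

(* The sum is the class of the union of any disjoint representatives. *)
Lemma cls_addU n (h : (0 < n)%N) (X Y : set 'rV[M]_n) (dX : definable X)
    (dY : definable Y) A B : X `&` Y = set0 -> def_iso X A -> def_iso Y B ->
  cls_add (cls A) (cls B) = cls (defU h dX dY).
Proof.
move=> dXY hX hY; symmetry; apply/cls_eqP.
apply: def_isoS => //.
- exact/(def_iso_trans hX)/def_iso_sym/repr_cls.
- exact/(def_iso_trans hY)/def_iso_sym/repr_cls.
Qed.

Lemma cls_addE A B : cls_add (cls A) (cls B) = cls (defS a0 A B).
Proof.
apply: cls_addU; first exact/defS_disj/a0_neq0.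
- exact/def_iso_sym/def_iso_inj_l/defsetP.
- exact/def_iso_sym/def_iso_inj_r/defsetP.
Qed.

Fact cls_addC : commutative cls_add.
Proof.
move=> u v; have [A ->] := cls_surj u; have [B ->] := cls_surj v.
rewrite cls_addE; apply/cls_eqP; rewrite /= setUC.
apply: def_isoS; first exact: a0_neq0.
- by rewrite setIC; exact/defS_disj/a0_neq0.
- exact/(def_iso_trans (def_iso_sym (def_iso_inj_r _ _ (defsetP B))))
    /def_iso_sym/repr_cls.
- exact/(def_iso_trans (def_iso_sym (def_iso_inj_l _ (defsetP A))))
    /def_iso_sym/repr_cls.
Qed.

Fact cls_addA : associative cls_add.
Proof.
move=> u v w; have [A ->] := cls_surj u; have [B ->] := cls_surj v.
have [C ->] := cls_surj w; rewrite !cls_addE.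
have [dA dB dC] := And3 (defsetP A) (defsetP B) (defsetP C).
have il n m (X : set 'rV[M]_n) (h : definable X) : def_iso (inj_l m @` X) X.
  exact/def_iso_sym/def_iso_inj_l.
have ir n m (X : set 'rV[M]_m) (h : definable X) : def_iso (inj_r a0 n @` X) X.
  exact/def_iso_sym/def_iso_inj_r.
have dl n m (X : set 'rV[M]_n) : definable X -> definable (inj_l m @` X).
  exact/definable_image/tmap_inj_l.
have dr n m (X : set 'rV[M]_m) : definable X -> definable (inj_r a0 n @` X).
  exact/definable_image/tmap_inj_r.
have disj n m (X : set 'rV[M]_n) (Y : set 'rV[M]_m) := defS_disj X Y a0_neq0.
apply/cls_eqP; rewrite /= !image_setU setUA.
apply: def_isoU.
- rewrite setIUl disj set0U; apply: image_disj; [exact: inj_r_inj|exact: disj].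
- by rewrite -image_setU disj.
- apply: def_isoU.
  + exact: disj.
  + apply: image_disj; [exact: inj_l_inj|exact: disj].
  + apply: (def_iso_trans (il _ _ _ dA)); apply: def_iso_sym.
    exact: def_iso_trans (il _ _ _ (dl _ _ _ dA)) (il _ _ _ dA).
  + apply: (def_iso_trans (ir _ _ _ (dl _ _ _ dB))).
    apply: (def_iso_trans (il _ _ _ dB)); apply: def_iso_sym.
    exact: def_iso_trans (il _ _ _ (dr _ _ _ dB)) (ir _ _ _ dB).
- apply: (def_iso_trans (ir _ _ _ (dr _ _ _ dC))).
  exact: def_iso_trans (ir _ _ _ dC) (def_iso_sym (ir _ _ _ dC)).
Qed.

Fact cls_add0 : left_id (cls def0) cls_add.
Proof.
move=> u; have [A ->] := cls_surj u.
rewrite (cls_addU (dim_gt0 A) (@definable0 _) (defsetP A)).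
- by apply/cls_eqP; rewrite /= set0U; exact/def_iso_refl/defsetP.
- exact: set0I.
- exact: def_iso_set0.
- exact/def_iso_refl/defsetP.
Qed.

Fact cls_mulC : commutative cls_mul.
Proof.
move=> u v; apply/cls_eqP; apply: def_iso_prodC; exact: defsetP.
Qed.

Fact cls_mulA : associative cls_mul.
Proof.
move=> u v w; have [A ->] := cls_surj u; have [B ->] := cls_surj v.
have [C ->] := cls_surj w; rewrite !cls_mulE; apply/cls_eqP.
apply: def_iso_prodA; exact: defsetP.
Qed.

Fact cls_mul1 : left_id (cls def1) cls_mul.
Proof.
move=> u; have [A ->] := cls_surj u; rewrite cls_mulE; apply/cls_eqP.
exact/def_iso_prod1/defsetP.
Qed.

Fact cls_mul0 : left_zero (cls def0) cls_mul.
Proof.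
move=> u; have [A ->] := cls_surj u; rewrite cls_mulE; apply/cls_eqP.
by apply: def_iso_set0 => //; apply/seteqP; split=> // x [].
Qed.

Fact cls_mulDl : left_distributive cls_mul cls_add.
Proof.
move=> u v w; have [A ->] := cls_surj u; have [B ->] := cls_surj v.
have [C ->] := cls_surj w; rewrite cls_addE !cls_mulE.
have [dA dB dC] := And3 (defsetP A) (defsetP B) (defsetP C).
have dl := definable_image (@tmap_inj_l _ (dim B)) dA.
have dr := definable_image (@tmap_inj_r a0 (dim A) _) dB.
rewrite (cls_addU (dim_gt0 (defM (defS a0 A B) C))
                  (definable_prod dl dC) (definable_prod dr dC)).
- apply/cls_eqP => /=.
  have -> : prod_set (inj_l (dim B) @` A) C `|` prod_set (inj_r a0 (dim A) @` B) C
      = prod_set (defS a0 A B) C.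
    apply/seteqP; split=> z; first by move=> [[? ?]|[? ?]]; split=> //; [left|right].
    by move=> [[?|?] ?]; [left|right].
  exact: (def_iso_refl (definable_prod (defsetP (defS a0 A B)) dC)).
- apply/seteqP; split=> // z [[zl _] [zr _]].
  have : set0 (lsubmx z) by rewrite -(defS_disj A B a0_neq0).
  by [].
- apply: def_iso_prod; last exact: def_iso_refl.
  exact/def_iso_sym/def_iso_inj_l.
- apply: def_iso_prod; last exact: def_iso_refl.
  exact/def_iso_sym/def_iso_inj_r.
Qed.

HB.instance Definition _ :=
  GRing.isNmodule.Build T cls_addA cls_addC cls_add0.
HB.instance Definition _ := GRing.Nmodule_isComPzSemiRing.Build T
  cls_mulA cls_mulC cls_mul1 cls_mulDl cls_mul0.

Lemma clsD n (h : (0 < n)%N) (X Y : set 'rV[M]_n) (dX : definable X)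
    (dY : definable Y) : X `&` Y = set0 ->
  cls (DefSet h dX) + cls (DefSet h dY) = cls (defU h dX dY).
Proof. by move=> dXY; apply: cls_addU => //; exact: def_iso_refl. Qed.

Lemma clsM A B : cls A * cls B = cls (defM A B).
Proof. exact: cls_mulE. Qed.

Lemma cls0 : 0 = cls def0. Proof. by []. Qed.
Lemma cls1 : 1 = cls def1. Proof. by []. Qed.

Definition K0 : comPzRingType := groth T.

End NonZero.

End Language.

(* Main.v *)
(* The ring homomorphism to Z is an Euler characteristic that counts finite
   cosets by their cardinality and gives every infinite coset the value 0.

   Every definable set is a Boolean combination of cosets of subgroups
   (Baur-Monk), so its indicator function is an integer combination of indicator
   functions of cosets, and its Euler characteristic is the same combination of
   the sizes of the cosets.  Well-definedness: if a combination of infinite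
   cosets equals a finitely supported function, apply a product of difference
   operators [f - f (_ + h)], one [h] in the direction of each infinite coset.
   The left-hand side dies, while each [h] can be chosen to move the support off
   itself, so the finitely supported function was 0.  Invariance under a
   definable bijection: the graph has the same characteristic as both of its
   projections, by counting along the fibres of each coset.

   Quantifier elimination holds for cosets of arbitrary subgroups and images
   under arbitrary additive maps: in a coset minus finitely many cosets,
   those of infinite index in the fibres do not affect the image (Neumann), and
   for the others the fibres are compared by counting cosets of a common
   subgroup of finite index, which is additive. *)
From HB Require Import structures.
Require Import Defs.
From mathcomp Require Import all_boot all_order all_algebra.
From mathcomp Require Import ring finmap.
From mathcomp Require Import boolp classical_sets functions cardinality.
Set Implicit Arguments.
Unset Strict Implicit.
Unset Printing Implicit Defensive.
Import GRing.Theory Num.Theory.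
Local Open Scope classical_set_scope.
Local Open Scope ring_scope.

(** * Well-definedness of the Euler characteristic *)

(* [fset_set A] is empty for an infinite [A], so infinite sets get size 0. *)
Definition finsize (T : choiceType) (A : set T) : int := (#|` fset_set A|)%:Z.

Lemma finsize_infinite (T : choiceType) (A : set T) :
  infinite_set A -> finsize A = 0.
Proof. by rewrite /finsize /fset_set; case: pselect. Qed.

Lemma finsize0 (T : choiceType) : finsize (@set0 T) = 0.
Proof. by rewrite /finsize fset_set0 cardfs0. Qed.

Lemma finsize1 (T : choiceType) (x : T) : finsize [set x] = 1.
Proof. by rewrite /finsize fset_set1 cardfs1. Qed.

Lemma finite_image_inj (T U : Type) (f : T -> U) (A : set T) :
  {in A &, injective f} -> finite_set (f @` A) -> finite_set A.
Proof.
move=> fI; have [[a _]|A0] := pselect (exists a, A a); last first.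
  move=> _; apply: sub_finite_set (finite_set0 T) => a Aa.
  by case: A0; exists a.
have [g gK] : exists g : U -> T, forall x, A x -> g (f x) = x.
  have /choice[g hg] : forall u, exists x,
      (exists2 y, A y & f y = u) -> A x /\ f x = u.
    move=> u; have [[y Ay yu]|n] := pselect (exists2 y, A y & f y = u).
      by exists y.
    by exists a.
  exists g => x Ax; have [] := hg (f x); first by exists x.
  by move=> Ag; apply: fI; exact: mem_set.
move=> /(finite_image g); apply: sub_finite_set => x Ax.
by exists (f x); [exists x|exact: gK].
Qed.

Lemma finsize_image (T U : choiceType) (f : T -> U) (A : set T) :
  {in A &, injective f} -> finsize (f @` A) = finsize A.
Proof.
move=> fI; have [fA|iA] := pselect (finite_set A); last first.
  rewrite !finsize_infinite // => fA; exact/iA/(finite_image_inj fI fA).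
rewrite /finsize fset_set_image // card_in_imfset // => x y.
by rewrite !in_fset_set //; exact: fI.
Qed.

(** The value 0 for infinite sets is compatible with products: an infinite factor times a nonempty
    one is infinite, and an empty factor makes both sides 0. *)
Lemma finsizeX (T U : choiceType) (A : set T) (B : set U) :
  finsize (A `*` B) = finsize A * finsize B.
Proof.
have [->|/set0P[a Aa]] := eqVneq A set0; first by rewrite set0X !finsize0 mul0r.
have [->|/set0P[b Bb]] := eqVneq B set0; first by rewrite setX0 !finsize0 mulr0.
have [fA|iA] := pselect (finite_set A); last first.
  rewrite (finsize_infinite iA) mul0r finsize_infinite // => h; apply: iA.
  apply: sub_finite_set (finite_image fst h) => x Ax; by exists (x, b).
have [fB|iB] := pselect (finite_set B); last first.
  rewrite (finsize_infinite iB) mulr0 finsize_infinite // => h; apply: iB.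
  apply: sub_finite_set (finite_image snd h) => x Bx; by exists (a, x).
rewrite /finsize fset_setX // -PoszM; congr Posz.
rewrite -(size_allpairs pair); apply/perm_size/uniq_perm.
- exact: fset_uniq.
- by apply: allpairs_uniq => // -[? ?] [? ?].
- move=> [x y]; rewrite in_fsetM; apply/andP/allpairsP => [[]|].
    by move=> /= xA yB; exists (x, y).
  by move=> [[x' y'] [/= xA yB [-> ->]]].
Qed.

Lemma finsize_sum (T : choiceType) (A : set T) (U : {fset T}) :
  finite_set A -> A `<=` [set` U] -> finsize A = \sum_(x <- U) (x \in A)%:R.
Proof.
move=> fA AU; rewrite /finsize -sum1_size -natz natr_sum.
have AU' : (fset_set A `<=` U)%fset.
  by apply/fsubsetP => x; rewrite in_fset_set // in_setE => /AU.
rewrite -(big_fset_incl _ AU'); last first.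
  by move=> x _; rewrite in_fset_set // => /negbTE->.
rewrite big_seq [RHS]big_seq; apply: eq_bigr => x.
by rewrite in_fset_set // => ->.
Qed.

(* [affset C]: [C] is empty or a coset of a subgroup. *)
Definition affset (G : zmodType) (C : set G) : Prop :=
  forall x y z, C x -> C y -> C z -> C (x - y + z).

(** The direction subgroup of a coset; it is empty when [C] is empty. *)
Definition dir (G : zmodType) (C : set G) : set G :=
  [set h | exists2 x, C x & C (x + h)].

Definition wsum (G : Type) (s : seq (int * set G)) (x : G) : int :=
  \sum_(p <- s) p.1 * (x \in p.2)%:R.

Definition wmass (G : choiceType) (s : seq (int * set G)) : int :=
  \sum_(p <- s) p.1 * finsize p.2.

(** * Annihilation by difference operators *)

Section Kills.
Variable G : zmodType.
Implicit Types (f g : G -> int) (l : seq (set G)) (s : seq (int * set G)).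

Lemma dirE (C : set G) h x : affset C -> dir C h -> C x <-> C (x + h).
Proof.
move=> aC [y Cy Cyh]; split=> Cx.
  have -> : x + h = (y + h) - y + x by rewrite [y + h]addrC addrK addrC.
  exact: aC.
have -> : x = y - (y + h) + (x + h).
  by rewrite opprD [y + (_ - _)]addrA subrr sub0r addrC addrK.
exact: aC.
Qed.

(* Every product of difference operators by one element of each member of [l]
   annihilates [f]. *)
Fixpoint killed l f : Prop :=
  if l is H :: l' then
    forall h, H h -> killed l' (fun x => f x - f (x + h))
  else forall x, f x = 0.

Lemma killed0 l : killed l (fun=> 0).
Proof.
by elim: l => //= H l + h _; congr killed.
Qed.

Lemma killedB l f g : killed l f -> killed l g -> killed l (fun x => f x - g x).
Proof.
elim: l f g => [|H l IH] f g /= kf kg; first by move=> x; rewrite kf kg subrr.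
move=> h Hh; have := IH _ _ (kf h Hh) (kg h Hh); congr killed.
by apply/funext => x /=; ring.
Qed.

Lemma killed_shift l f a : killed l f -> killed l (fun x => f (x + a)).
Proof.
elim: l f => [|H l IH] f /= kf; first by move=> x; rewrite kf.
move=> h Hh; have := IH _ (kf h Hh); congr killed.
by apply/funext => x /=; rewrite addrAC.
Qed.

(** For [h] in the direction of [p.2], the indicator of [p.2] is invariant under translation by [h],
    so the first operator removes the term of [p]. *)
Lemma killed_wsum s : {in s, forall p, affset p.2} ->
  killed [seq dir p.2 | p <- s] (wsum s).
Proof.
elim: s => [|p s IH] ha; first by move=> x; rewrite /wsum big_nil.
move=> h ph; have {}IH : killed [seq dir p0.2 | p0 <- s] (wsum s).
  by apply: IH => q qs; apply: ha; rewrite inE qs orbT.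
have := killedB IH (killed_shift h IH); congr killed; apply/funext => x.
rewrite /wsum !big_cons.
have -> : (x + h \in p.2) = (x \in p.2).
  have pE := dirE x (ha p (mem_head _ _)) ph.
  by apply/idP/idP; rewrite !in_setE => /pE.
by ring.
Qed.

(* Each infinite set contains a shift moving the support of [f] off itself. *)
Lemma killed_finite l f : {in l, forall H, infinite_set H} ->
  finite_set [set x | f x <> 0] -> killed l f -> forall x, f x = 0.
Proof.
elim: l f => [|H l IH] f //= hl fin kf x; apply: contrapT => fx.
set A := [set x | f x <> 0] in fin.
have [h Hh nh] : exists2 h, H h & ~ [set y - z | y in A & z in A] h.
  apply: contrapT => nh; apply: (hl H); first by rewrite inE eqxx.
  apply: sub_finite_set (finite_image2 (fun y z => y - z) fin fin) => h Hh.
  by apply: contrapT => h'; apply: nh; exists h.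
have e y : f y - f (y + h) = 0.
  apply: (IH (fun y => f y - f (y + h))); last exact: kf.
    by move=> K Kl; apply: hl; rewrite inE Kl orbT.
  apply: (@sub_finite_set _ _ (A `|` [set z - h | z in A])); last first.
    by rewrite finite_setU; split => //; exact: finite_image.
  move=> z /= fz; case: (pselect (f z = 0)) => [fz0|]; last by left.
  right; exists (z + h); last by rewrite addrK.
  by move=> fzh; apply: fz; rewrite fz0 fzh subrr.
(* Since [f x = f (x + h)], both points lie in the support, so [h] is one of the excluded
   differences. *)
apply: nh; exists (x + h); last by exists x => //; rewrite addrAC subrr add0r.
by move=> E; apply: fx; rewrite -[f x]subr0 -E e.
Qed.

Lemma dir_infinite (C : set G) : infinite_set C -> infinite_set (dir C).
Proof.
move=> iC fin; have [x0 Cx0] := infinite_setN0 iC; apply: iC.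
apply: sub_finite_set (finite_image (+%R x0) fin) => x Cx.
exists (x - x0); last by rewrite addrC subrK.
by exists x0 => //; rewrite addrC subrK.
Qed.

(** Split the list into its finite sets [F] and infinite sets [I]. The function of [F] is minus that
    of [I], hence killed by infinite directions; having finite support it vanishes, and its sum over
    [U] is the mass. *)
Lemma wmass0 s : {in s, forall p, affset p.2} ->
  (forall x, wsum s x = 0) -> wmass s = 0.
Proof.
move=> ha hs.
pose fin := [pred p : int * set G | `[< finite_set p.2 >]].
set F := [seq p <- s | fin p]; set I := [seq p <- s | ~~ fin p].
have sFI x : wsum s x = wsum F x + wsum I x.
  by rewrite /wsum /F /I !big_filter (bigID fin).
have finF p : p \in F -> finite_set p.2.
  by rewrite mem_filter => /andP[/asboolP].
pose U : {fset G} := (\bigcup_(p <- F) fset_set p.2)%fset.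
have pU p : p \in F -> p.2 `<=` [set` U].
  move=> pF x px; apply/bigfcupP; exists p; rewrite ?pF //.
  by rewrite in_fset_set ?in_setE //; exact: finF.
have F0 : forall x, wsum F x = 0.
  apply: (@killed_finite [seq dir p.2 | p <- I]).
  - move=> H /mapP[p]; rewrite mem_filter => /andP[/asboolPn np _] ->.
    exact: dir_infinite.
  - apply: (sub_finite_set _ (finite_fset U)) => x /= wx; apply: contrapT => xU.
    apply: wx; rewrite /wsum big_seq big1 // => p pF.
    rewrite memNset ?mulr0 // => px; exact/xU/(pU p pF).
  - have -> : wsum F = (fun x => 0 - wsum I x).
      by apply/funext => x; rewrite -(hs x) sFI addrK.
    apply: (killedB (killed0 _)).
    by apply: killed_wsum => p; rewrite mem_filter => /andP[_]; exact: ha.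
rewrite /wmass (bigID fin) /= [X in _ + X]big1 ?addr0; last first.
  by move=> p /asboolPn np; rewrite finsize_infinite ?mulr0.
rewrite -big_filter -/F big_seq.
under eq_bigr => p pF do rewrite (finsize_sum (finF p pF) (pU p pF)) mulr_sumr.
rewrite -big_seq exchange_big big1 // => x _; exact: F0.
Qed.

End Kills.

(** * Combinations of cosets *)

(** Additive maps up to a constant; constants occur because terms contain parameters. *)
Definition affmap (G H : zmodType) (f : G -> H) : Prop :=
  forall x y z, f (x - y + z) = f x - f y + f z.

Definition represents (G : zmodType) (s : seq (int * set G)) (A : set G) :=
  {in s, forall p, affset p.2} /\ forall x, wsum s x = (x \in A)%:R.

Definition constructible (G : zmodType) (A : set G) :=
  exists s, represents s A.

Lemma additive_affmap (G H : zmodType) (f : {additive G -> H}) : affmap f.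
Proof. by move=> x y z; rewrite raddfD raddfB. Qed.

Lemma affset_sub1 (G : zmodType) (C : set G) :
  (forall x y, C x -> C y -> x = y) -> affset C.
Proof. by move=> C1 x y z Cx Cy Cz; rewrite (C1 x y) // subrr add0r. Qed.

Lemma affset1 (G : zmodType) (a : G) : affset [set a].
Proof. by apply: affset_sub1 => x y -> ->. Qed.

Lemma affsetI (G : zmodType) (C D : set G) :
  affset C -> affset D -> affset (C `&` D).
Proof.
by move=> aC aD x y z [? ?] [? ?] [? ?]; split; [exact: aC|exact: aD].
Qed.

Lemma affsetX (G H : zmodType) (C : set G) (D : set H) :
  affset C -> affset D -> affset (C `*` D).
Proof.
by move=> aC aD x y z [? ?] [? ?] [? ?]; split; [exact: aC|exact: aD].
Qed.

Section Affmap.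
Variables (G H : zmodType) (f : G -> H).
Hypothesis fA : affmap f.
Implicit Types (C : set G).

Lemma affset_preimage (D : set H) : affset D -> affset (f @^-1` D).
Proof. by move=> aD x y z /= *; rewrite fA; exact: aD. Qed.

Lemma affset_image C : affset C -> affset (f @` C).
Proof.
move=> aC _ _ _ [x Cx <-] [y Cy <-] [z Cz <-]; rewrite -fA.
by exists (x - y + z) => //; exact: aC.
Qed.

Definition fiber (C : set G) (y : H) : set G := C `&` f @^-1` [set y].

Lemma affset_fiber C y : affset C -> affset (fiber C y).
Proof.
by move=> aC; apply: affsetI => //; apply: affset_preimage; exact: affset1.
Qed.

(* The size of a nonempty fibre; they all have the same size. *)
Definition fiber_size C : int := finsize (fiber C (f (xget 0 C))).

(** For [c] and [c0] in [C], translation by [c - c0] carries the fibre through [c0] onto the fibre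
    through [c]. *)
Lemma finsize_fiber C y : affset C ->
  finsize (fiber C y) = fiber_size C * (y \in f @` C)%:R.
Proof.
move=> aC; case: (pselect ((f @` C) y)) => [fCy|nCy]; last first.
  rewrite [_ \in _]memNset // mulr0 -[RHS](@finsize0 G); congr finsize.
  by apply/seteqP; split=> // x [Cx fx]; case: nCy; exists x.
rewrite mem_set // mulr1 /fiber_size; case: fCy => c Cc <- {y}.
set c0 := xget 0 C; have Cc0 : C c0 by apply: (@xgetPex _ 0); exists c.
rewrite -(@finsize_image _ _ (fun x => x - c0 + c) (fiber C (f c0)));
  last first.
  by move=> x y _ _ /= /addIr /addIr.
congr finsize; apply/seteqP; split=> [x [Cx /= fx]|_ [x [Cx /= fx] <-]].
  exists (x - c + c0); last by rewrite addrK subrK.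
  by split; [exact: aC|rewrite /= fA fx subrr add0r].
by split; [exact: aC|rewrite /= fA fx subrr add0r].
Qed.

(** A section [g] of [f] over the image identifies fibre times image with [C], sending [(k, y)] to
    [k - c0 + g y]; [finsizeX] covers the infinite cases. *)
Lemma finsize_total C : affset C ->
  finsize C = fiber_size C * finsize (f @` C).
Proof.
move=> aC; rewrite /fiber_size; set c0 := xget 0 C.
have [[c Cc]|C0] := pselect (exists c, C c); last first.
  have -> : C = set0 by apply/seteqP; split=> // c Cc; case: C0; exists c.
  by rewrite image_set0 !finsize0 mulr0.
have Cc0 : C c0 by apply: (@xgetPex _ 0); exists c.
have [g hg] : exists g, forall y, (f @` C) y -> C (g y) /\ f (g y) = y.
  have /choice[g hg] : forall y, exists x, (f @` C) y -> C x /\ f x = y.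
    move=> y; case: (pselect ((f @` C) y)) => [[x Cx fx]|n]; first by exists x.
    by exists 0.
  by exists g.
have fE k y : fiber C (f c0) k -> (f @` C) y -> f (k - c0 + g y) = y.
  by move=> [_ /= fk] /hg[_ gy]; rewrite fA fk subrr add0r gy.
rewrite -finsizeX -(@finsize_image _ _ (fun p => p.1 - c0 + g p.2)).
  congr finsize; apply/seteqP; split=> [x Cx|_ [[k y] [/= [Ck _] /hg[? _]] <-]].
    have [|Cg gE] := hg (f x); first by exists x.
    exists (x - g (f x) + c0, f x); last by rewrite /= addrK subrK.
    by split; [split; [exact: aC|rewrite /= fA gE subrr add0r]|exists x].
  exact: aC.
move=> [k y] [k' y'] /set_mem[/= Ck fy] /set_mem[/= Ck' fy'] E.
have yE : y = y' by rewrite -(fE k y) // E fE.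
by move: E; rewrite yE => /addIr/addIr->.
Qed.

End Affmap.

Section Represents.
Variable G : zmodType.
Implicit Types (s t : seq (int * set G)) (A B : set G).

Lemma wsum_nil (x : G) : wsum [::] x = 0.
Proof. exact: big_nil. Qed.

Lemma wsum_cons p s (x : G) : wsum (p :: s) x = p.1 * (x \in p.2)%:R + wsum s x.
Proof. exact: big_cons. Qed.

Lemma wsum_cat s t (x : G) : wsum (s ++ t) x = wsum s x + wsum t x.
Proof. exact: big_cat. Qed.

Lemma wsum_scale c s (x : G) :
  wsum [seq (c * p.1, p.2) | p <- s] x = c * wsum s x.
Proof. by rewrite /wsum big_map mulr_sumr; apply: eq_bigr => p _ /=; ring. Qed.

Lemma wsumI s B x :
  wsum [seq (p.1, p.2 `&` B) | p <- s] x = wsum s x * (x \in B)%:R.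
Proof.
rewrite /wsum big_map mulr_suml; apply: eq_bigr => p _ /=.
by rewrite in_setI -mulrA -natrM mulnb.
Qed.

(** Appending [t] with opposite weights to [s] reduces this to [wmass0]. *)
Lemma wmass_eq s t :
  {in s, forall p, affset p.2} -> {in t, forall p, affset p.2} ->
  wsum s =1 wsum t -> wmass s = wmass t.
Proof.
move=> hs ht E; apply/eqP; rewrite -subr_eq0 -mulN1r; apply/eqP.
have -> : wmass s + -1 * wmass t = wmass (s ++ [seq (-1 * p.1, p.2) | p <- t]).
  rewrite /wmass big_cat big_map mulr_sumr; congr (_ + _).
  by apply: eq_bigr => p _; rewrite /= mulrA.
apply: wmass0 => [p|x]; last by rewrite wsum_cat wsum_scale E; ring.
by rewrite mem_cat => /orP[/hs|/mapP[q /ht aq ->]].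
Qed.

Lemma represents_aff A : affset A -> represents [:: (1, A)] A.
Proof.
move=> aA; split=> [p|x]; first by rewrite inE => /eqP->.
by rewrite wsum_cons wsum_nil mul1r addr0.
Qed.

Lemma represents_uniq s t A :
  represents s A -> represents t A -> wmass s = wmass t.
Proof. by move=> [hs sE] [ht tE]; apply: wmass_eq => // x; rewrite sE tE. Qed.

Lemma represents_disjU s t A B : A `&` B = set0 ->
  represents s A -> represents t B -> represents (s ++ t) (A `|` B).
Proof.
move=> AB [hs sE] [ht tE]; split=> [p|x].
  by rewrite mem_cat => /orP[/hs|/ht].
rewrite wsum_cat sE tE in_setU -natrD; congr (_%:R).
have := in_setI x A B; rewrite AB in_set0.
by case: (x \in A) (x \in B) => [] [].
Qed.

(* Fubini: counting along the fibres of [f] and then over the base. *)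
Lemma represents_image (H : zmodType) (f : G -> H) s A : affmap f ->
  {in A &, injective f} -> represents s A ->
  exists2 t, represents t (f @` A) & wmass t = wmass s.
Proof.
move=> fA fI [hs sE].
(* Each coset is pushed forward with its weight multiplied by its fibre size; infinite fibres give
   weight 0. *)
exists [seq (p.1 * fiber_size f p.2, f @` p.2) | p <- s]; last first.
  rewrite /wmass big_map big_seq [RHS]big_seq; apply: eq_bigr => p ps /=.
  by rewrite -mulrA -finsize_total //; exact: hs.
split=> [_ /mapP[p ps ->]|y]; first exact/affset_image/hs.
transitivity (wmass [seq (p.1, fiber f p.2 y) | p <- s]).
  rewrite /wsum /wmass !big_map big_seq [RHS]big_seq; apply: eq_bigr => p ps /=.
  by rewrite -mulrA -finsize_fiber //; exact: hs.
have A1 x x' : fiber f A y x -> fiber f A y x' -> x = x'.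
  by move=> [Ax /= fx] [Ax' /= fx']; apply: fI; rewrite ?in_setE // fx fx'.
(* The fibres of the single cosets may be infinite, but their combination is the indicator of a
   fibre of [A], which has at most one point; well-definedness gives its mass. *)
transitivity (wmass [:: (1, fiber f A y)]).
  apply: wmass_eq => [_ /mapP[p ps ->]|p|x].
  - exact/affset_fiber/hs.
  - by rewrite inE => /eqP->; exact: affset_sub1.
  - by rewrite wsumI sE wsum_cons wsum_nil addr0 mul1r in_setI -natrM mulnb.
rewrite /wmass big_seq1 mul1r.
have [[x Ax]|nA] := pselect ((f @` A) y).
  move=> fx; rewrite mem_set; last by exists x.
  rewrite -(finsize1 x); congr finsize; apply/seteqP; split=> [x' Ax'|_ ->] //.
  by apply: A1.
rewrite memNset // -[RHS](finsize0 G); congr finsize.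
by apply/seteqP; split=> // x [Ax fx]; case: nA; exists x.
Qed.

End Represents.

Lemma represents_setX (G H : zmodType) (s : seq (int * set G))
    (t : seq (int * set H)) (A : set G) (B : set H) :
  represents s A -> represents t B ->
  exists2 u, represents u (A `*` B) & wmass u = wmass s * wmass t.
Proof.
move=> [hs sE] [ht tE].
exists [seq (p.1 * q.1, p.2 `*` q.2) | p <- s, q <- t]; last first.
  rewrite /wmass big_allpairs_dep mulr_suml; apply: eq_bigr => p _.
  by rewrite mulr_sumr; apply: eq_bigr => q _ /=; rewrite finsizeX; ring.
split=> [_ /allpairsP[[p q] [/hs ? /ht ? ->]]|[x y]]; first exact: affsetX.
have mX (C : set G) (D : set H) : ((x, y) \in C `*` D) = (x \in C) && (y \in D).
  apply/idP/andP; rewrite !in_setE => -[] //.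
rewrite mX -mulnb natrM -sE -tE /wsum big_allpairs_dep mulr_suml.
apply: eq_bigr => p _; rewrite mulr_sumr; apply: eq_bigr => q _ /=.
by rewrite mX -mulnb natrM; ring.
Qed.

(** * Constructible sets and Neumann's lemma *)

Section Constructible.
Variable G : zmodType.
Implicit Types A B C : set G.

Lemma constructible_aff A : affset A -> constructible A.
Proof. by move=> aA; eexists; exact: represents_aff. Qed.

Lemma constructible0 : constructible (@set0 G).
Proof. by apply: constructible_aff; exact: affset_sub1. Qed.

Lemma constructibleC A : constructible A -> constructible (~` A).
Proof.
move=> [s [hs sE]]; exists ((1, setT) :: [seq (-1 * p.1, p.2) | p <- s]); split.
  by move=> p; rewrite inE => /predU1P[-> //|/mapP[q /hs aq ->]].
move=> x; rewrite wsum_cons wsum_scale sE in_setC in_setT.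
by case: (x \in A).
Qed.

Lemma constructibleI A B :
  constructible A -> constructible B -> constructible (A `&` B).
Proof.
move=> [s [hs sE]] [t [ht tE]].
exists [seq (p.1 * q.1, p.2 `&` q.2) | p <- s, q <- t].
split=> [_ /allpairsP[[p q] [/hs ? /ht ? ->]]|x]; first exact: affsetI.
rewrite in_setI -mulnb natrM -sE -tE /wsum big_allpairs_dep mulr_suml.
apply: eq_bigr => p _; rewrite mulr_sumr; apply: eq_bigr => q _ /=.
by rewrite in_setI -mulnb natrM; ring.
Qed.

Lemma constructibleU A B :
  constructible A -> constructible B -> constructible (A `|` B).
Proof.
move=> cA cB; rewrite -[_ `|` _]setCK setCU.
by apply: constructibleC; apply: constructibleI; exact: constructibleC.
Qed.

(** The constant [c] absorbs the weight of the first set, which makes induction on the list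
    possible. *)
Lemma wsum_cons_neq0 c p s :
  [set x : G | c + wsum (p :: s) x <> 0] =
  (p.2 `&` [set x | c + p.1 + wsum s x <> 0]) `|`
  (~` p.2 `&` [set x | c + wsum s x <> 0]).
Proof.
apply/seteqP; split=> x /=; rewrite wsum_cons.
- have [px|px] := pselect (p.2 x).
    by rewrite mem_set // mulr1 addrA; left.
  by rewrite memNset // mulr0 add0r; right.
- by move=> [[px]|[px]]; [rewrite mem_set // mulr1 addrA|
    rewrite memNset // mulr0 add0r].
Qed.

(** Recognises a set from any combination supported on it, such as one that counts points instead of
    taking the values 0 and 1. *)
Lemma constructible_neq0 c s : {in s, forall p, affset p.2} ->
  constructible [set x : G | c + wsum s x <> 0].
Proof.
elim: s c => [|p s IH] c hs.
  have [->|/eqP c0] := eqVneq c 0.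
    have -> : [set x : G | 0 + wsum [::] x <> 0] = set0.
      by apply/seteqP; split=> // x /=; rewrite wsum_nil addr0.
    exact: constructible0.
  have -> : [set x : G | c + wsum [::] x <> 0] = setT.
    by apply/seteqP; split=> // x _ /=; rewrite wsum_nil addr0.
  exact: constructible_aff.
have {}IH d : constructible [set x : G | d + wsum s x <> 0].
  by apply: IH => q qs; apply: hs; rewrite inE qs orbT.
have cp : constructible p.2 by apply/constructible_aff/hs/mem_head.
rewrite wsum_cons_neq0; apply: constructibleU; apply: constructibleI => //.
exact: constructibleC.
Qed.

End Constructible.

Lemma constructible_preimage (G H : zmodType) (f : G -> H) (B : set H) :
  affmap f -> constructible B -> constructible (f @^-1` B).
Proof.
move=> fA [s [hs sE]]; exists [seq (p.1, f @^-1` p.2) | p <- s].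
split=> [_ /mapP[p ps ->]|x]; first by apply: affset_preimage => //; exact: hs.
have mE (D : set H) : (x \in f @^-1` D) = (f x \in D).
  by apply/idP/idP; rewrite !in_setE.
by rewrite mE -sE /wsum big_map; apply: eq_bigr => p _ /=; rewrite mE.
Qed.

(** A subgroup or the empty set, since [dir] of an empty set is empty; membership of 0 is stated
    separately. *)
Definition subclosed (G : zmodType) (H : set G) : Prop :=
  forall x y, H x -> H y -> H (x - y).

Lemma constructible_setX (G H : zmodType) (A : set G) (B : set H) :
  constructible A -> constructible B -> constructible (A `*` B).
Proof.
by move=> [s sA] [t tB]; have [u ? _] := represents_setX sA tB; exists u.
Qed.

(* [H] meets [K] in a subgroup of finite index of [K] (when both are groups). *)
Definition fin_index (G : zmodType) (K H : set G) : Prop :=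
  exists t : seq G, forall k, K k -> exists2 a, a \in t & H (k - a).

(** * Neumann's lemma and coset transversals *)

Section Index.
Variable G : zmodType.
Implicit Types (C E H K N : set G) (s l : seq (set G)).

Lemma subclosedN H x : H 0 -> subclosed H -> H x -> H (- x).
Proof. by move=> H0 sH Hx; rewrite -sub0r; exact: sH. Qed.

Lemma subclosedD H x y : H 0 -> subclosed H -> H x -> H y -> H (x + y).
Proof.
move=> H0 sH Hx Hy; rewrite -[y]opprK.
by apply: (sH) => //; exact: subclosedN.
Qed.

Lemma subclosed_dir C : affset C -> subclosed (dir C).
Proof.
move=> aC x y dx [v Cv Cvy]; exists (v + y) => //.
by rewrite addrACA subrr addr0; apply/(dirE v aC dx).
Qed.

(* B. H. Neumann: a group is not a finite union of cosets of subgroups of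
   infinite index.  A coset of [H] missed by the sets lying in cosets of [H] is
   covered by the other sets, hence so is every coset of [H], after
   translation; this removes [H] from [l]. *)
Lemma neumann K l s : K 0 -> subclosed K ->
  {in l, forall H, subclosed H /\ ~ fin_index K H} ->
  {in s, forall E, exists2 H, H \in l & forall x y, E x -> E y -> H (x - y)} ->
  ~ (forall k, K k -> exists2 E, E \in s & E k).
Proof.
move=> K0 sK; elim: l s => [|H l IH] s hl hs cov.
  by have [E /hs[]] := cov 0 K0.
have [sH nH] := hl H (mem_head _ _).
pose P E := `[< forall x y, E x -> E y -> H (x - y) >].
pose s1 := [seq E <- s | P E]; pose s2 := [seq E <- s | ~~ P E].
(* The finitely many points [xget 0 E] cannot represent all cosets of [H] in [K]; an empty [E] only
   adds the harmless point 0. *)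
have [k Kk kH] : exists2 k, K k & forall a, a \in [seq xget 0 E | E <- s1] ->
    ~ H (k - a).
  apply: contrapT => nk; apply: nH; exists [seq xget 0 E | E <- s1] => k Kk.
  apply: contrapT => na; apply: nk; exists k => // a at1 Ha.
  by apply: na; exists a.
have cov2 h : H h -> K h -> exists2 E, E \in s2 & E (k + h).
  move=> Hh Kh; have [E Es Ekh] := cov _ (subclosedD K0 sK Kk Kh).
  exists E => //; rewrite mem_filter Es andbT; apply/negP => PE.
  apply: (kH (xget 0 E)); first by apply: map_f; rewrite mem_filter PE.
  have Eg : E (xget 0 E) by apply: (@xgetPex _ 0); exists (k + h).
  have := sH _ _ ((asboolP _ PE) _ _ Ekh Eg) Hh.
  by rewrite addrAC addrK.
have hl' : {in l, forall H, subclosed H /\ ~ fin_index K H}.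
  by move=> H' H'l; apply: hl; rewrite inE H'l orbT.
have hs2 : {in s2, forall E, exists2 H, H \in l &
    forall x y, E x -> E y -> H (x - y)}.
  move=> E; rewrite mem_filter => /andP[/asboolPn nP /hs[H' + hE]].
  by rewrite inE => /predU1P[EH|?]; [case: nP; rewrite -EH|exists H'].
(* If [z] lies in [E] and [K], and [e] is the chosen point there, then [z - e] is in [H], so
   [z - e + k] is covered by [s2]. The translates of [s2] thus replace each [E] of [s1]. *)
pose shift E E' : set G := [set x | E' (x - xget 0 (E `&` K) + k)].
apply: (IH (s2 ++ [seq shift E E' | E <- s1, E' <- s2]) hl').
  move=> E; rewrite mem_cat => /orP[/hs2 //|/allpairsP[[F F']]].
  move=> /= [_ /hs2[H' H'l hF'] ->]; exists H' => // x y /hF' h /h.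
  set e := xget _ _; have -> // : x - e + k - (y - e + k) = x - y.
  by rewrite -[x - e + k]addrA -[y - e + k]addrA opprD addrACA subrr addr0.
move=> z Kz; have [E Es Ez] := cov z Kz.
have [PE|nPE] := boolP (P E); last first.
  by exists E => //; rewrite mem_cat mem_filter nPE Es.
have [Ee Ke] : (E `&` K) (xget 0 (E `&` K)).
  by apply: (@xgetPex _ 0); exists z.
set e := xget _ _ in Ee Ke.
have [E' E's E'h] := cov2 _ ((asboolP _ PE) _ _ Ez Ee) (sK _ _ Kz Ke).
exists (shift E E'); last by rewrite /shift /= addrC.
rewrite mem_cat; apply/orP; right; apply: allpairs_f => //.
by rewrite mem_filter PE.
Qed.

(** Representatives are picked in the nonempty intersections of a coset of [H1] with a coset of
    [H2]. *)
Lemma fin_indexI K H1 H2 : subclosed H1 -> subclosed H2 ->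
  fin_index K H1 -> fin_index K H2 -> fin_index K (H1 `&` H2).
Proof.
move=> sH1 sH2 [t1 h1] [t2 h2].
pose r a b := xget 0 [set k | H1 (k - a) /\ H2 (k - b)].
exists [seq r a b | a <- t1, b <- t2] => k Kk.
have [a at1 ka] := h1 k Kk; have [b bt2 kb] := h2 k Kk.
exists (r a b); first exact: allpairs_f.
have [ra rb] : [set k | H1 (k - a) /\ H2 (k - b)] (r a b).
  by apply: (@xgetPex _ 0); exists k.
have E c x : k - c - (x - c) = k - x by rewrite opprB addrA subrK.
by split; [rewrite -(E a); exact: sH1|rewrite -(E b); exact: sH2].
Qed.

(** The list given by [fin_index] may leave [K] and repeat cosets. Choosing a point in each nonempty
    trace of a coset on [K] cures the first; [xget] picks the same point for equal traces, so
    [undup] cures the second. *)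
Lemma coset_transversal K N : N 0 -> subclosed N -> fin_index K N ->
  exists t : seq G, [/\ uniq t, {in t, forall a, K a},
    forall k, K k -> exists2 a, a \in t & N (k - a) &
    {in t &, forall a b, N (a - b) -> a = b}].
Proof.
move=> N0 sN [t0 ht0].
pose R a := [set k | K k /\ N (k - a)].
have RE a x : N (x - a) -> R a = R x.
  move=> ax; apply/seteqP; split=> k [Kk kN]; split => //.
    have -> : k - x = (k - a) - (x - a) by rewrite opprB addrA subrK.
    exact: sN.
  have -> : k - a = (k - x) + (x - a) by rewrite addrA subrK.
  exact: subclosedD.
exists (undup [seq xget 0 (R a) | a <- t0 & `[< exists k, R a k >]]); split.
- exact: undup_uniq.
- move=> b; rewrite mem_undup => /mapP[a].
  rewrite mem_filter => /andP[/asboolP].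
  by move=> /(@xgetPex _ 0)[Ka _] _ ->.
- move=> k Kk; have [a at0 ka] := ht0 k Kk.
  have Ra : exists k, R a k by exists k.
  exists (xget 0 (R a)).
    rewrite mem_undup; apply: map_f; rewrite mem_filter at0 andbT.
    exact/asboolP.
  have [_ ra] := @xgetPex _ 0 _ Ra.
  have -> : k - xget 0 (R a) = (k - a) - (xget 0 (R a) - a).
    by rewrite opprB addrA subrK.
  exact: sN.
move=> b b'; rewrite !mem_undup => /mapP[a + ->] /mapP[a' + ->].
rewrite !mem_filter => /andP[/asboolP Ra _] /andP[/asboolP Ra' _].
have [_ ra] := @xgetPex _ 0 _ Ra; have [_ ra'] := @xgetPex _ 0 _ Ra'.
by move=> /RE e; congr xget; rewrite (RE _ _ ra) (RE _ _ ra').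
Qed.

(** Translation by [d] permutes the cosets of [N] that meet [K], and [F] is constant on cosets. *)
Lemma coset_transversal_sum K N (t : seq G) (F : G -> int) d :
  subclosed N -> N 0 -> subclosed K -> K 0 ->
  uniq t -> {in t, forall a, K a} ->
  (forall k, K k -> exists2 a, a \in t & N (k - a)) ->
  {in t &, forall a b, N (a - b) -> a = b} ->
  (forall x n, N n -> F (x + n) = F x) -> K d ->
  \sum_(a <- t) F (a + d) = \sum_(a <- t) F a.
Proof.
move=> sN N0 sK K0 ut tK tc ti FN Kd.
have [r hr] : exists r, forall a, a \in t -> r a \in t /\ N (a + d - r a).
  have /choice[r hr] : forall a, exists b, a \in t -> b \in t /\ N (a + d - b).
    move=> a; have [at_|] := boolP (a \in t); last by exists 0.
    by have [b bt hb] := tc _ (subclosedD K0 sK (tK a at_) Kd); exists b.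
  by exists r.
have rI : {in t &, injective r}.
  move=> a b at_ bt E; apply: ti => //.
  have := sN _ _ (hr a at_).2 (hr b bt).2.
  by rewrite E opprB addrA subrK opprD addrA addrAC addrK.
have pt : perm_eq [seq r a | a <- t] t.
  apply: uniq_perm => //; first by rewrite map_inj_in_uniq.
  apply: (uniq_min_size _ _ _).2; rewrite ?size_map ?map_inj_in_uniq //.
  by move=> _ /mapP[a /hr[? _] ->].
rewrite -[RHS](perm_big _ pt) big_map [LHS]big_seq [RHS]big_seq.
apply: eq_bigr => a /hr[_ ran].
by rewrite -(FN (r a) _ ran) [r a + _]addrC subrK.
Qed.

End Index.

(** * Images of constructible sets *)

Definition block (G : zmodType) (C : set G) (l : seq (set G)) : set G :=
  [set x | C x /\ forall E, E \in l -> ~ E x].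

Section Projection.
Variables (G H : zmodType) (f : {additive G -> H}).
Implicit Types (C E : set G) (l : seq (set G)).

(** Inclusion-exclusion; a property [P] stable under intersection with members of [l] passes to
    every set in the combination. *)
Lemma block_wsum (P : set G -> Prop) C l :
  P C -> (forall D E, P D -> E \in l -> P (D `&` E)) ->
  exists2 s, {in s, forall p, P p.2} &
    forall x, wsum s x = (x \in block C l)%:R.
Proof.
move=> PC; elim: l => [|E l IH] PI.
  exists [:: (1, C)] => [p|x]; first by rewrite inE => /eqP->.
  have -> : block C [::] = C by apply/seteqP; split=> [y []|y Cy] //; split.
  by rewrite wsum_cons wsum_nil mul1r addr0.
have [|s hs sE] := IH.
  by move=> D F PD Fl; apply: PI; rewrite // inE Fl orbT.
exists (s ++ [seq (-1 * p.1, p.2) | p <- [seq (p.1, p.2 `&` E) | p <- s]]).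
  move=> p; rewrite mem_cat => /orP[/hs //|/mapP[_ /mapP[q /hs Pq ->] ->]].
  by apply: PI; rewrite ?mem_head.
move=> x; rewrite wsum_cat wsum_scale wsumI sE.
have -> : block C (E :: l) = block C l `&` ~` E.
  apply/seteqP; split=> y.
    move=> [Cy ly]; split; last exact/ly/mem_head.
    by split=> // F Fl; apply: ly; rewrite inE Fl orbT.
  by move=> [[Cy ly] Ey]; split=> // F; rewrite inE => /predU1P[->|/ly].
rewrite in_setI in_setC.
by case: (x \in block C l) (x \in E) => [] [].
Qed.

Lemma constructible_image_block C l :
  affset C -> {in l, forall E, affset E} -> constructible (f @` block C l).
Proof.
move=> aC al.
have [[c0 Cc0]|C0] := pselect (exists c, C c); last first.
  have -> : f @` block C l = set0; last exact: constructible0.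
  by apply/seteqP; split=> // y [x [Cx _] _]; case: C0; exists x.
(* The fibre of [C] through a point [y] of [C] is [y + K]. *)
pose K : set G := [set k | f k = 0 /\ dir C k].
have K0 : K 0 by split; [exact: raddf0|exists c0; rewrite ?addr0].
have sK : subclosed K.
  move=> x y [fx dx] [fy dy]; split; first by rewrite /= raddfB fx fy subrr.
  exact: subclosed_dir.
pose P E := `[< fin_index K (dir E) >].
pose lf := [seq E <- l | P E].
(* [N] has finite index in [K], and [C] and the sets of [lf] are invariant under it. *)
pose N : set G := [set k | K k /\ forall E, E \in lf -> dir E k].
have lfP E : E \in lf -> affset E /\ fin_index K (dir E).
  by rewrite mem_filter => /andP[/asboolP ? /al].
have N0 : N 0.
  (* Finite index forces [dir E] to be nonempty, so [E] has a point and 0 is in [dir E]. *)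
  split=> // E /lfP[_ [t ht]]; have [a _ [x Ex _]] := ht 0 K0.
  by exists x; rewrite ?addr0.
have sN : subclosed N.
  move=> x y [Kx dx] [Ky dy]; split=> [|E El]; first exact: sK.
  by apply: subclosed_dir; [exact: (lfP E El).1|exact: dx|exact: dy].
have fN : fin_index K N.
  rewrite /N; elim: lf lfP {N N0 sN} => [|E lf' IH] lfP.
    by exists [:: 0] => k Kk; exists 0; rewrite ?mem_head // subr0; split.
  have [|aE fE] := lfP E; first exact: mem_head.
  have lfP' F : F \in lf' -> affset F /\ fin_index K (dir F).
    by move=> Fl; apply: lfP; rewrite inE Fl orbT.
  have -> : [set k | K k /\ forall F, F \in E :: lf' -> dir F k] =
      dir E `&` [set k | K k /\ forall F, F \in lf' -> dir F k].
    apply/seteqP; split=> k /=.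
      move=> [Kk dk]; split; first exact/dk/mem_head.
      by split=> // F Fl; apply: dk; rewrite inE Fl orbT.
    by move=> [dE [Kk dk]]; split=> // F; rewrite inE => /predU1P[->|/dk].
  apply: fin_indexI => //; [exact: subclosed_dir| |exact: IH].
  move=> x y [Kx dx] [Ky dy]; split=> [|F Fl]; first exact: sK.
  by apply: subclosed_dir; [exact: (lfP' F Fl).1|exact: dx|exact: dy].
have blockN x n : N n -> block C lf x <-> block C lf (x + n).
  move=> [[_ Cn] En]; rewrite /block /=; split=> -[Cx lx].
    split=> [|E El]; first exact/(dirE x aC Cn).
    by move=> /(dirE x (lfP E El).1 (En E El)); exact: lx.
  split=> [|E El]; first exact/(dirE x aC Cn).
  by move=> /(dirE x (lfP E El).1 (En E El)); exact: lx.
have fblock : f @` block C l = f @` block C lf.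
  apply/seteqP; split=> _ [y By <-].
    exists y => //; split=> [|E]; first by case: By.
    by rewrite mem_filter => /andP[_]; case: By => _; apply.
  (* Write [k] in [K] as a representative [a] plus an element of [N]. Then [y + (k - a)] is in
     [block C lf] with image [f y], so it lies in a set of [li]. The sets [sh E a] would cover [K],
     against [neumann]. *)
  apply: contrapT => nB; have [t ht] := fN.
  pose li := [seq E <- l | ~~ P E].
  pose sh E a : set G := [set x | E (y + (x - a))].
  apply: (@neumann _ K [seq dir E | E <- li]
    [seq sh E a | E <- li, a <- t]) => //.
  - move=> _ /mapP[E + ->]; rewrite mem_filter => /andP[/asboolPn nE /al aE].
    by split=> //; exact: subclosed_dir.
  - move=> _ /allpairsP[[E a] [/= Eli at_ ->]].
    exists (dir E); first exact: map_f.
    move=> x x' Ex Ex'; exists (y + (x' - a)) => //.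
    by rewrite -addrA [_ + (x - x')]addrC [x - x' + _]addrA subrK.
  move=> k Kk; have [a at_ Na] := ht k Kk.
  have [Cyk lfyk] := (blockN y _ Na).1 By.
  have [E El Eyk] : exists2 E, E \in l & E (y + (k - a)).
    apply: contrapT => nE; apply: nB; exists (y + (k - a)).
      by split=> // E El Eyk; apply: nE; exists E.
    by rewrite raddfD (proj1 (proj1 Na)) addr0.
  exists (sh E a) => //; apply: allpairs_f => //; rewrite mem_filter El andbT.
  by apply/negP => PE; apply: (lfyk E) => //; rewrite mem_filter PE.
have [t [ut tK tc ti]] := coset_transversal N0 sN fN.
have [s hs sE] : exists2 s, {in s, forall p, [/\ affset p.2, p.2 `<=` C &
      forall x n, N n -> p.2 x -> p.2 (x + n)]} &
    forall x, wsum s x = (x \in block C lf)%:R.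
  apply: (@block_wsum (fun D => [/\ affset D, D `<=` C &
      forall x n, N n -> D x -> D (x + n)])) => [|D E [aD DC ND] El].
    by split=> // x n [[_ Cn] _]; apply: (dirE x aC Cn).1.
  split=> [|x [/DC]|x n Nn [Dx Ex]] //.
    by apply: affsetI => //; exact: (lfP E El).1.
  by split; [exact: ND|apply: (dirE x (lfP E El).1 (Nn.2 E El)).1].
pose cnt E y : int := \sum_(a <- t) (y + a \in E)%:R.
(* If [e'] in [p.2] has the same image as [y], then [y - e'] is in [K] and permutes the cosets of
   [N], so the count at [y] equals the count at the chosen point of [p.2]. *)
have cntE p y : p \in s -> C y ->
    cnt p.2 y = cnt p.2 (xget 0 p.2) * (f y \in f @` p.2)%:R.
  case: p => c E /hs[/= aE EC NE] Cy; set e := xget 0 E.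
  have [[e' Ee' fe']|nE] := pselect ((f @` E) (f y)); last first.
    rewrite [f y \in _]memNset // mulr0 /cnt big_seq big1 // => a at_.
    rewrite memNset // => Ea; apply: nE; exists (y + a) => //.
    by rewrite raddfD (tK a at_).1 addr0.
  have Ee : E e by apply: (@xgetPex _ 0); exists e'.
  rewrite mem_set ?mulr1; last by exists e'.
  have Kd : K (y - e').
    split; first by rewrite raddfB fe' subrr.
    by exists e'; [exact: EC|rewrite addrC subrK].
  have NE' x n : N n -> E (x + n) <-> E x.
    move=> Nn; split=> [Exn|]; last exact: NE.
    by rewrite -[x](addrK n); apply: NE => //; exact: subclosedN.
  pose F b : int := (e + b \in E)%:R.
  have FN x n : N n -> F (x + n) = F x.
    move=> Nn; congr (nat_of_bool _)%:R; rewrite addrA.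
    by apply/idP/idP; rewrite !in_setE => /(NE' _ _ Nn).
  rewrite /cnt -[RHS](coset_transversal_sum sN N0 sK K0 ut tK tc ti FN Kd).
  apply: eq_bigr => a _; congr (nat_of_bool _)%:R.
  apply/idP/idP; rewrite !in_setE => h.
    have -> : e + (a + (y - e')) = (y + a) - e' + e.
      by rewrite addrC [y + a]addrC addrA.
    exact: aE.
  have -> : y + a = (e + (a + (y - e'))) - e + e'.
    by rewrite [e + _]addrC addrK addrA subrK addrC.
  exact: aE.
pose g := [seq (p.1 * cnt p.2 (xget 0 p.2), f @` p.2) | p <- s].
(* Thus [g] counts the cosets of [N] in a fibre that lie in the block, and the image is where this
   count is nonzero. *)
have gE y : C y -> wsum g (f y) = \sum_(a <- t) (y + a \in block C lf)%:R.
  move=> Cy; under [RHS]eq_bigr => a _ do rewrite -sE.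
  rewrite /wsum exchange_big big_map big_seq [RHS]big_seq.
  apply: eq_bigr => p ps.
  by rewrite /= -mulrA -cntE // mulr_sumr.
have -> : f @` block C l = [set x | 0 + wsum g x <> 0].
  rewrite fblock; apply/seteqP; split=> [_ [y By <-]|x] /=.
    rewrite add0r gE; last by case: By.
    (* This [a] represents the coset of 0, so it lies in [N] and [y + a] stays in the block. *)
    have [a at_ Na] := tc 0 K0.
    have Bya : block C lf (y + a).
      apply: (blockN y a _).1 => //; rewrite -[a]opprK -[- a]sub0r.
      exact: subclosedN.
    move/eqP; rewrite psumr_eq0; last by move=> *; exact: ler0n.
    by move=> /allP /(_ a at_); rewrite mem_set.
  rewrite add0r => gx.
  have [y Cy yx] : exists2 y, C y & f y = x.
    apply: contrapT => nC; apply: gx.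
    rewrite /wsum big_map big_seq big1 // => p /hs[_ pC _].
    rewrite memNset ?mulr0 // => -[y /pC Cy yx].
    by apply: nC; exists y.
  apply: contrapT => nB; apply: gx; rewrite -yx gE // big_seq big1 // => a at_.
  rewrite memNset // => By; apply: nB; exists (y + a) => //.
  by rewrite raddfD (tK a at_).1 addr0.
apply: constructible_neq0 => _ /mapP[p /hs[aE _ _] ->].
exact/affset_image/aE/additive_affmap.
Qed.

(** Induction on the list cuts [A] into blocks: each coset is either intersected with [C] or added
    to the excluded sets. At the end [c] decides whether the block is kept. *)
Lemma constructible_image (A : set G) :
  constructible A -> constructible (f @` A).
Proof.
move=> [s [hs sE]].
have -> : A = block setT [::] `&` [set x | 0 + wsum s x <> 0].
  apply/seteqP; split=> x; rewrite /= sE add0r.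
    by move=> Ax; rewrite mem_set.
  by have [//|nA] := pselect (A x); rewrite memNset // => -[].
suff : forall C l c, affset C -> {in l, forall E, affset E} ->
    constructible (f @` (block C l `&` [set x | c + wsum s x <> 0])) by apply.
elim: s hs {sE} => [|p s IH] hs C l c aC al.
  have [->|/eqP c0] := eqVneq c 0.
    rewrite (_ : _ `&` _ = set0) ?image_set0; first exact: constructible0.
    by apply/seteqP; split=> // x [_ /=]; rewrite wsum_nil addr0.
  rewrite (_ : _ `&` _ = block C l); first exact: constructible_image_block.
  apply/seteqP; split=> [x [] //|x Bx]; split; first exact: Bx.
  by rewrite /= wsum_nil addr0.
have ap := hs p (mem_head _ _).
have {}IH : forall C l c, affset C -> {in l, forall E, affset E} ->
    constructible (f @` (block C l `&` [set x | c + wsum s x <> 0])).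
  by apply: IH => q qs; apply: hs; rewrite inE qs orbT.
rewrite wsum_cons_neq0 setIUr !setIA image_setU; apply: constructibleU.
  rewrite (_ : block C l `&` p.2 = block (C `&` p.2) l).
    by apply: IH => //; exact: affsetI.
  by apply/seteqP; split=> x [[? ?] ?]; split.
rewrite (_ : block C l `&` ~` p.2 = block C (p.2 :: l)).
  by apply: IH => // E; rewrite inE => /predU1P[->|/al].
apply/seteqP; split=> x.
  by move=> [[Cx lx] px]; split=> // E; rewrite inE => /predU1P[->|/lx].
move=> [Cx lx]; split; last exact/lx/mem_head.
by split=> // E El; apply: lx; rewrite inE El orbT.
Qed.

End Projection.

(** * The Euler characteristic of definable sets *)

(** The mass is unique by [represents_uniq]; sets that are not constructible get the default 0. *)
Definition euler (G : zmodType) (A : set G) : int :=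
  xget 0 [set m | exists2 s, represents s A & wmass s = m].

Lemma eulerE (G : zmodType) (A : set G) s : represents s A -> euler A = wmass s.
Proof.
move=> sA; apply: xget_subset1; first by exists s.
by move=> _ _ [t tA <-] [t' tA' <-]; exact: represents_uniq tA tA'.
Qed.

Lemma euler_aff (G : zmodType) (A : set G) : affset A -> euler A = finsize A.
Proof.
by move=> /represents_aff/eulerE->; rewrite /wmass big_seq1 mul1r.
Qed.

Lemma euler_image (G H : zmodType) (f : G -> H) (A : set G) :
  affmap f -> {in A &, injective f} -> constructible A ->
  euler (f @` A) = euler A.
Proof.
move=> fA fI [s sA]; have [t tA tE] := represents_image fA fI sA.
by rewrite (eulerE tA) (eulerE sA).
Qed.

Lemma euler_setX (G H : zmodType) (A : set G) (B : set H) :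
  constructible A -> constructible B -> euler (A `*` B) = euler A * euler B.
Proof.
move=> [s sA] [t tB]; have [u /eulerE-> ->] := represents_setX sA tB.
by rewrite (eulerE sA) (eulerE tB).
Qed.

Lemma euler_disjU (G : zmodType) (A B : set G) : A `&` B = set0 ->
  constructible A -> constructible B -> euler (A `|` B) = euler A + euler B.
Proof.
move=> AB [s sA] [t tB].
rewrite (eulerE (represents_disjU AB sA tB)) (eulerE sA) (eulerE tB).
exact: big_cat.
Qed.

Section Definable.
Variables (R : pzRingType) (M : lmodType R^c).

(** Formulas are interpreted in the group of all environments, so that [Ex] is the image under this
    one additive map. *)
Definition behead_env (e : nat -> M) : nat -> M := fun i => e i.+1.

Fact behead_env_is_zmod_morphism : zmod_morphism behead_env.
Proof. by []. Qed.

HB.instance Definition _ := GRing.isZmodMorphism.Build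
  (nat -> M) (nat -> M) behead_env behead_env_is_zmod_morphism.

Lemma eval_affmap (t : term M) : affmap (fun e : nat -> M => eval e t).
Proof.
move=> x y z /=; elim: t => /= [i|a||t -> u ->|t ->|r t ->] //=.
- by rewrite subrr add0r.
- by rewrite subrr add0r.
- by rewrite addrACA [_ - _ + (_ - _)]addrACA -opprD.
- by rewrite !opprD opprK.
- by rewrite scalerDr scalerBr.
Qed.

Lemma holds_constructible (p : formula M) :
  constructible [set e : nat -> M | holds e p].
Proof.
elim: p => [t u|p IH|p IHp q IHq|p IH].
- apply: constructible_aff => x y z /= hx hy hz.
  by rewrite !(eval_affmap _ x y z) hx hy hz.
- exact: constructibleC IH.
- exact: constructibleI IHp IHq.
have -> : [set e | holds e (Ex p)] = behead_env @` [set e | holds e p].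
  apply/seteqP; split=> e /= [a h]; first by exists (scons a e).
  move=> <-; exists (a 0%N); congr (holds _ p): h.
  by apply/funext => -[].
exact: constructible_image.
Qed.

Lemma env_affmap n : affmap (@env R M n).
Proof.
move=> x y z; apply/funext => i; rewrite /env !fctE.
by case: insubP => [j _ _|_]; rewrite ?mxE // subrr addr0.
Qed.

Lemma definable_constructible n (A : set 'rV[M]_n) :
  definable A -> constructible A.
Proof.
move=> [p hp].
have -> : A = @env R M n @^-1` [set e | holds e p].
  by apply/seteqP; split=> x /hp.
exact/(constructible_preimage (@env_affmap n))/holds_constructible.
Qed.

Lemma euler_def_iso n m (A : set 'rV[M]_n) (B : set 'rV[M]_m) :
  def_iso A B -> euler A = euler B.
Proof.
move=> [f [[fAB fI fB] /definable_constructible cG]].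
have -> : A = lsubmx @` graph A f.
  apply/seteqP; split=> [x Ax|_ [_ [x Ax <-] <-]]; last by rewrite row_mxKl.
  by exists (row_mx x (f x)); [exists x|rewrite row_mxKl].
have -> : B = rsubmx @` graph A f.
  apply/seteqP; split=> [_ /fB[x Ax <-]|_ [_ [x Ax <-] <-]].
    by exists (row_mx x (f x)); [exists x|rewrite row_mxKr].
  by rewrite row_mxKr; exact: fAB.
have lI : {in graph A f &, injective (@lsubmx M 1 n m)}.
  by move=> _ _ /set_mem[x Ax <-] /set_mem[y Ay <-]; rewrite !row_mxKl => ->.
have rI : {in graph A f &, injective (@rsubmx M 1 n m)}.
  move=> _ _ /set_mem[x Ax <-] /set_mem[y Ay <-].
  by rewrite !row_mxKr => /(fI _ _ (mem_set Ax) (mem_set Ay)) ->.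
by rewrite (euler_image _ lI cG) ?(euler_image _ rI cG) // => x y z;
  apply/rowP => i; rewrite !mxE.
Qed.

Lemma euler_prod_set n m (A : set 'rV[M]_n) (B : set 'rV[M]_m) :
  definable A -> definable B -> euler (prod_set A B) = euler A * euler B.
Proof.
move=> /definable_constructible cA /definable_constructible cB.
rewrite -euler_setX //.
have -> : prod_set A B = (fun p => row_mx p.1 p.2) @` (A `*` B).
  apply/seteqP; split=> [z [Az Bz]|_ [[x y] [/= Ax By] <-]].
    by exists (lsubmx z, rsubmx z); rewrite ?hsubmxK.
  by split; rewrite ?row_mxKl ?row_mxKr.
apply: euler_image; last exact: constructible_setX.
- by move=> x y z /=; rewrite opp_row_mx !add_row_mx.
- by move=> [x y] [x' y'] _ _ /= /eq_row_mx[-> ->].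
Qed.

Section NonZero.
Hypothesis hM : exists a : M, a != 0.

Definition euler_cls (u : Deftilde hM) : int := euler (@carrier _ _ (repr u)).

Lemma euler_clsE (A : defset M) : euler_cls (cls hM A) = euler A.
Proof. exact/euler_def_iso/repr_cls. Qed.

Fact euler_cls_is_nmod_morphism : nmod_morphism euler_cls.
Proof.
split=> [|u v].
  by rewrite euler_clsE euler_aff ?finsize0 //; exact: affset_sub1.
have [A ->] := cls_surj u; have [B ->] := cls_surj v.
rewrite [_ + _ in LHS]cls_addE !euler_clsE /=.
have a0 := xchooseP hM.
have dA := defsetP A; have dB := defsetP B.
rewrite euler_disjU; [|exact: defS_disj| |].
- by rewrite -(euler_def_iso (def_iso_inj_l _ dA))
    -(euler_def_iso (def_iso_inj_r _ _ dB)).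
- exact/definable_constructible/definable_image/dA/tmap_inj_l.
- exact/definable_constructible/definable_image/dB/tmap_inj_r.
Qed.

Fact euler_cls_is_monoid_morphism : monoid_morphism euler_cls.
Proof.
split=> [|u v].
  by rewrite euler_clsE euler_aff ?finsize1 //; exact: affset1.
have [A ->] := cls_surj u; have [B ->] := cls_surj v.
by rewrite clsM !euler_clsE euler_prod_set //; exact: defsetP.
Qed.

HB.instance Definition _ := GRing.isNmodMorphism.Build
  (Deftilde hM) int euler_cls euler_cls_is_nmod_morphism.
HB.instance Definition _ := GRing.isMonoidMorphism.Build
  (Deftilde hM) int euler_cls euler_cls_is_monoid_morphism.

End NonZero.
End Definable.

Theorem corollary5p2p11 (R : pzRingType) (M : lmodType R^c)
    (hM : exists a : M, a != 0) :
  exists (i : {rmorphism int -> K0 hM}) (r : {rmorphism K0 hM -> int}),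
    injective i /\ cancel i r.
Proof.
(* The universal property extends [euler_cls] to the Grothendieck ring. *)
have [r [[rB rM _] _]] :=
  groth_universal (@euler_cls R M hM : {rmorphism _ -> _}).
pose r' : {rmorphism K0 hM -> int} := HB.pack r
  (GRing.isZmodMorphism.Build _ _ r rB) (GRing.isMonoidMorphism.Build _ _ r rM).
exists ( *~%R 1 : {rmorphism int -> K0 hM}), r'.
(* A ring homomorphism sends [n] times 1 to [n] times 1, so [r'] is a left inverse of the canonical
   map. *)
have iK : cancel ( *~%R (1 : K0 hM)) r' by move=> n; rewrite rmorph_int intz.
by split=> //; exact: can_inj iK.
Qed.
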